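(* For $A, B \in M_+(n,\mathbb{C})$, we have $$\int_0^1 A\#_{\nu}B\,d\nu \geq A\#_{2/3}B-A\#_{1/3}B+2\left\{ (A\#_{1/3}B)^{-1}+A^{-1}\right\}^{-1} \geq A\#_{1/2}B.$$
   Context: $M_+(n,\mathbb{C})$ is the set of all $n\times n$ positive semidefinite complex matrices. For $0\le\nu\le1$, $A\#_{\nu}B \equiv A^{1/2}(A^{-1/2}BA^{-1/2})^{\nu}A^{1/2}$ is the $\nu$-weighted geometric mean introduced by Kubo and Ando. Inequalities between Hermitian matrices are in the Loewner order ($S\le T$ means $T-S$ is positive semidefinite). Powers are defined by the functional calculus and the integral is taken entrywise. *)

(* Defs.v *)
From mathcomp Require Import all_boot all_order all_algebra.
From mathcomp Require Import complex.
From mathcomp Require Import all_classical all_reals all_analysis.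

Set Implicit Arguments.
Unset Strict Implicit.
Unset Printing Implicit Defensive.

Import Order.TTheory GRing.Theory Num.Theory.
Import numFieldNormedType.Exports.

Local Open Scope classical_set_scope.
Local Open Scope ring_scope.
Local Open Scope complex_scope.
Local Open Scope sesquilinear_scope.

(* The order on R[i] makes [0 <= z] mean that z is real and nonnegative. *)
Definition psdmx (R : realType) (n : nat) (A : 'M[R[i]]_n) : Prop :=
  A \is hermsymmx /\ forall v : 'rV[R[i]]_n, 0 <= (v *m A *m v ^t*) 0 0.

Definition loewner_le (R : realType) (n : nat) (S T : 'M[R[i]]_n) : Prop :=
  psdmx (T - S).

(* Functional calculus, meaningful for Hermitian A: mathcomp's spectral theorem
   gives A = P^-1 D P with P := spectralmx A unitary and D the diagonal matrix
   of spectral_diag A, which is real. *)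
Definition funcalc (R : realType) (n : nat) (f : R -> R) (A : 'M[R[i]]_n) :
    'M[R[i]]_n :=
  invmx (spectralmx A)
    *m diag_mx (map_mx (fun z : R[i] => (f (complex.Re z))%:C) (spectral_diag A))
    *m spectralmx A.

Definition mxpow (R : realType) (n : nat) (A : 'M[R[i]]_n) (r : R) :
    'M[R[i]]_n :=
  funcalc (fun x => x `^ r) A.

(* Entrywise integral over [0, 1] for the Lebesgue measure. *)
Definition mxint01 (R : realType) (n : nat) (F : R -> 'M[R[i]]_n) :
    'M[R[i]]_n :=
  \matrix_(i, j)
    (Rintegral (@lebesgue_measure R) `[0%R, 1%R]
       (fun t => complex.Re (F t i j))
     +i* Rintegral (@lebesgue_measure R) `[0%R, 1%R]
       (fun t => complex.Im (F t i j))).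

(* Entrywise limit as e tends to 0 from above. *)
Definition mxlim0 (R : realType) (n : nat) (F : R -> 'M[R[i]]_n) :
    'M[R[i]]_n :=
  \matrix_(i, j)
    (lim (complex.Re (F e i j) @[e --> (0 : R)^'+])
     +i* lim (complex.Im (F e i j) @[e --> (0 : R)^'+])).

Definition wgmean_formula (R : realType) (n : nat) (nu : R)
    (A B : 'M[R[i]]_n) : 'M[R[i]]_n :=
  mxpow A (2^-1)
    *m mxpow (mxpow A (- 2^-1) *m B *m mxpow A (- 2^-1)) nu
    *m mxpow A (2^-1).

(* The weighted geometric mean A #_nu B. The formula needs A invertible; for
   singular A the mean is the Kubo-Ando extension by continuity from above,
   the limit of (A + e I) #_nu (B + e I) as e decreases to 0. *)
Definition wgmean (R : realType) (n : nat) (nu : R) (A B : 'M[R[i]]_n) :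
    'M[R[i]]_n :=
  if A \in unitmx then wgmean_formula nu A B
  else mxlim0 (fun e : R =>
         wgmean_formula nu (A + (e%:C)%:M) (B + (e%:C)%:M)).

(* The parallel sum (X^-1 + Y^-1)^-1, half the harmonic mean, extended to
   singular positive semidefinite arguments in the same way. *)
Definition parsum (R : realType) (n : nat) (X Y : 'M[R[i]]_n) :
    'M[R[i]]_n :=
  if (X \in unitmx) && (Y \in unitmx) then invmx (invmx X + invmx Y)
  else mxlim0 (fun e : R =>
         invmx (invmx (X + (e%:C)%:M) + invmx (Y + (e%:C)%:M))).

(* Main.v *)
(* If A is invertible, write A = S^* S and B = S^* D S with S invertible and D
   diagonal and nonnegative. Then A #_nu B = S^* D^nu S, the parallel sum is
   S^* (D^(1/3) / (1 + D^(1/3))) S, and both inequalities reduce to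
     x^(1/2) <= x^(2/3) - x^(1/3) + 2 x^(1/3) / (1 + x^(1/3)) <= int_0^1 x^nu dnu
   for x >= 0. With x = t^3 the middle term is (t^3 + t) / (t + 1) and the integral
   (t^3 - 1) / (3 ln t); the second inequality holds because the derivative of
   (t^3 - 1)(t + 1) / (3 (t^3 + t)) - ln t is a nonnegative multiple of
   (t - 1)^4 (t^2 + t + 1).

   If A is singular, apply this to A + e and B + e and let e decrease to 0. The
   means decrease with e because the weighted mean is jointly monotone: for the
   weight 1/2 by its variational characterisation, in general because the weights
   with this property form a closed set containing 0 and 1 and stable under
   midpoints. So the means converge, and dominated convergence handles the
   integral. The parallel sum X : Y has the form
   v |-> inf_a <a X, a> + <(v - a) Y, v - a>, so it commutes with decreasing
   limits in both arguments. *)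

Require Import Defs.
From mathcomp Require Import all_boot all_order all_algebra.
From mathcomp Require Import ring lra.
From mathcomp Require Import complex.
From mathcomp Require Import all_classical all_reals all_analysis measurable_realfun.

Set Implicit Arguments.
Unset Strict Implicit.
Unset Printing Implicit Defensive.

Import Order.TTheory GRing.Theory Num.Theory.
Import numFieldNormedType.Exports.

Local Open Scope classical_set_scope.
Local Open Scope ring_scope.
Local Open Scope complex_scope.
Local Open Scope sesquilinear_scope.

(** * Hermitian forms *)

(* The conjugate transpose, stated with [conjc] so that it lives directly in
   the ring structure of R[i]; it is convertible to [A ^t*]. *)
Definition adjmx (R : realType) m n (A : 'M[R[i]]_(m, n)) : 'M[R[i]]_(n, m) :=
  map_mx (@conjc R) A^T.

Lemma ReM (R : realType) (x y : R[i]) :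
  complex.Re (x * y) = complex.Re x * complex.Re y - complex.Im x * complex.Im y.
Proof. by case: x y => [a b] [c d]. Qed.

Lemma Re_realM (R : realType) (c : R) (z : R[i]) :
  complex.Re (c%:C * z) = c * complex.Re z.
Proof. by rewrite ReM /= mul0r subr0. Qed.

Lemma ReD (R : realType) (x y : R[i]) :
  complex.Re (x + y) = complex.Re x + complex.Re y.
Proof. by case: x y => [a b] [c d]. Qed.

Lemma Re_conj (R : realType) (x : R[i]) :
  complex.Re (conjc x) = complex.Re x.
Proof. by case: x. Qed.

Lemma Im_conj (R : realType) (x : R[i]) :
  complex.Im (conjc x) = - complex.Im x.
Proof. by case: x. Qed.

Lemma Re_sum (R : realType) I (r : seq I) (P : pred I) (F : I -> R[i]) :
  complex.Re (\sum_(i <- r | P i) F i) = \sum_(i <- r | P i) complex.Re (F i).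
Proof. by apply: big_morph => // x y; rewrite ReD. Qed.

(** The real part keeps limits, integrals and comparisons in [R]. No information is lost: the
    imaginary part reappears when one vector is multiplied by i, and for Hermitian [M] the form is
    symmetric. *)
Definition bform (R : realType) (n : nat) (M : 'M[R[i]]_n) (x y : 'rV[R[i]]_n) : R :=
  complex.Re ((x *m M *m adjmx y) 0 0).

Definition rform (R : realType) (n : nat) (M : 'M[R[i]]_n) (v : 'rV[R[i]]_n) : R :=
  bform M v v.

Lemma adjmxK (R : realType) m n (A : 'M[R[i]]_(m, n)) : adjmx (adjmx A) = A.
Proof. by apply/matrixP => i j; rewrite !mxE conjcK. Qed.

Lemma adjmxM (R : realType) m n p (A : 'M[R[i]]_(m, n)) (B : 'M[R[i]]_(n, p)) :
  adjmx (A *m B) = adjmx B *m adjmx A.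
Proof. by rewrite /adjmx trmx_mul map_mxM. Qed.

Lemma adjmxD (R : realType) m n (A B : 'M[R[i]]_(m, n)) :
  adjmx (A + B) = adjmx A + adjmx B.
Proof. by apply/matrixP => i j; rewrite !mxE rmorphD. Qed.

Lemma adjmx1 (R : realType) n : adjmx (1%:M : 'M[R[i]]_n) = 1%:M.
Proof. by rewrite /adjmx trmx1 map_mx1. Qed.

Lemma adjmxN (R : realType) m n (A : 'M[R[i]]_(m, n)) : adjmx (- A) = - adjmx A.
Proof. by apply/matrixP => i j; rewrite !mxE rmorphN. Qed.

Lemma adjmxZ (R : realType) m n (c : R) (A : 'M[R[i]]_(m, n)) :
  adjmx (c%:C *: A) = c%:C *: adjmx A.
Proof.
apply/matrixP => i j; rewrite !mxE rmorphM; congr (_ * _).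
exact: conjc_real.
Qed.

Definition rdiag (R : realType) n (d : 'I_n -> R) : 'M[R[i]]_n :=
  diag_mx (\row_k (d k)%:C).

Lemma adjmx_rdiag (R : realType) n (d : 'I_n -> R) : adjmx (rdiag d) = rdiag d.
Proof.
rewrite /adjmx tr_diag_mx; apply/matrixP => i j; rewrite !mxE.
rewrite rmorphMn; congr (_ *+ _); exact: conjc_real.
Qed.

Lemma rdiagM (R : realType) n (d e : 'I_n -> R) :
  rdiag d *m rdiag e = rdiag (fun k => d k * e k).
Proof.
rewrite mulmx_diag; congr diag_mx; apply/rowP => k.
by rewrite !mxE rmorphM.
Qed.

Lemma rdiag_cst (R : realType) n (c : R) :
  rdiag (fun _ : 'I_n => c) = (c%:C)%:M.
Proof. by rewrite -diag_const_mx; congr diag_mx; apply/rowP => k; rewrite !mxE. Qed.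

Lemma rdiagD (R : realType) n (d e : 'I_n -> R) :
  rdiag d + rdiag e = rdiag (fun k => d k + e k).
Proof.
rewrite -raddfD; congr diag_mx; apply/rowP => k.
by rewrite !mxE rmorphD.
Qed.

Lemma hermsymmxE (R : realType) n (A : 'M[R[i]]_n) :
  A \is hermsymmx <-> adjmx A = A.
Proof.
by split=> [/is_hermitianmxP|e]; last apply/is_hermitianmxP;
  rewrite expr0 scale1r.
Qed.

Lemma adjmx_psd (R : realType) n (A : 'M[R[i]]_n) : psdmx A -> adjmx A = A.
Proof. by case=> /hermsymmxE. Qed.

(** The 1 by 1 matrix [w] is its own adjoint, so its entry equals its conjugate. *)
Lemma Im_herm_form (R : realType) n (A : 'M[R[i]]_n) (v : 'rV[R[i]]_n) : adjmx A = A ->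
  complex.Im ((v *m A *m adjmx v) 0 0) = 0.
Proof.
move=> hA; set w := v *m A *m adjmx v.
have hw : adjmx w = w by rewrite /w !adjmxM adjmxK hA mulmxA.
have: (adjmx w) 0 0 = w 0 0 by rewrite hw.
rewrite !mxE => /(congr1 (@complex.Im _)).
by rewrite Im_conj => ?; lra.
Qed.

Lemma psdmxE (R : realType) n (A : 'M[R[i]]_n) :
  psdmx A <-> adjmx A = A /\ forall v, 0 <= rform A v.
Proof.
split=> [[/hermsymmxE hA pA]|[hA pA]]; split=> //.
- by move=> v; have := pA v; rewrite lecE => /andP[].
- exact/hermsymmxE.
by move=> v; rewrite lecE Im_herm_form //= eqxx; exact: pA.
Qed.

Lemma rform_ge0 (R : realType) n (A : 'M[R[i]]_n) v : psdmx A -> 0 <= rform A v.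
Proof. by move=> /psdmxE[]. Qed.

Lemma bformDl (R : realType) n (A : 'M[R[i]]_n) x x' y :
  bform A (x + x') y = bform A x y + bform A x' y.
Proof. by rewrite /bform !mulmxDl mxE ReD. Qed.

Lemma bformDr (R : realType) n (A : 'M[R[i]]_n) x y y' :
  bform A x (y + y') = bform A x y + bform A x y'.
Proof. by rewrite /bform adjmxD mulmxDr mxE ReD. Qed.

Lemma bformD (R : realType) n (A B : 'M[R[i]]_n) x y :
  bform (A + B) x y = bform A x y + bform B x y.
Proof. by rewrite /bform mulmxDr mulmxDl mxE ReD. Qed.

Lemma bformN (R : realType) n (A : 'M[R[i]]_n) x y :
  bform (- A) x y = - bform A x y.
Proof. by rewrite /bform mulmxN mulNmx mxE; case: (_ 0 0). Qed.

Lemma bformZ (R : realType) n c (A : 'M[R[i]]_n) x y :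
  bform (c%:C *: A) x y = c * bform A x y.
Proof. by rewrite /bform -scalemxAr -scalemxAl mxE ReM /= mul0r subr0. Qed.

Lemma bformC (R : realType) n (A : 'M[R[i]]_n) x y : adjmx A = A ->
  bform A x y = bform A y x.
Proof.
move=> hA; rewrite /bform -{1}[x]adjmxK -{1}hA -!adjmxM mulmxA mxE.
by rewrite mxE Re_conj.
Qed.

Lemma rformD (R : realType) n (A B : 'M[R[i]]_n) v :
  rform (A + B) v = rform A v + rform B v.
Proof. exact: bformD. Qed.

Lemma rformB (R : realType) n (A B : 'M[R[i]]_n) v :
  rform (A - B) v = rform A v - rform B v.
Proof. by rewrite /rform bformD bformN. Qed.

Lemma rformZ (R : realType) n c (A : 'M[R[i]]_n) v :
  rform (c%:C *: A) v = c * rform A v.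
Proof. exact: bformZ. Qed.

Lemma rform_addv (R : realType) n (A : 'M[R[i]]_n) x y : adjmx A = A ->
  rform A (x + y) = rform A x + rform A y + 2 * bform A x y.
Proof.
move=> hA; rewrite /rform bformDl !bformDr (bformC y x hA); ring.
Qed.

Lemma loewner_leE (R : realType) n (A B : 'M[R[i]]_n) : adjmx A = A -> adjmx B = B ->
  loewner_le A B <-> forall v, rform A v <= rform B v.
Proof.
move=> hA hB; rewrite /loewner_le psdmxE; split=> [[_ h] v|h].
  by rewrite -subr_ge0 -rformB.
by split=> [|v]; [rewrite adjmxD adjmxN hA hB | rewrite rformB subr_ge0].
Qed.

Lemma bform_congr (R : realType) n (S M : 'M[R[i]]_n) x y :
  bform (adjmx S *m M *m S) x y = bform M (x *m adjmx S) (y *m adjmx S).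
Proof. by rewrite /bform adjmxM adjmxK !mulmxA. Qed.

Lemma rform_congr (R : realType) (n : nat) (S M : 'M[R[i]]_n) v :
  rform (adjmx S *m M *m S) v = rform M (v *m adjmx S).
Proof. exact: bform_congr. Qed.

(** A real linear combination of the real and imaginary parts of the entries: this is how entrewise
    limits and integrals pass to forms. *)
Lemma bform_expand (R : realType) n (M : 'M[R[i]]_n) x y :
  bform M x y = \sum_i \sum_j
    (complex.Re (x 0 i * conjc (y 0 j)) * complex.Re (M i j)
     - complex.Im (x 0 i * conjc (y 0 j)) * complex.Im (M i j)).
Proof.
rewrite /bform mxE Re_sum exchange_big /=; apply: eq_bigr => j _.
rewrite mxE mulr_suml Re_sum; apply: eq_bigr => i _.
by rewrite !mxE mulrAC ReM.
Qed.

Lemma bform_delta (R : realType) n (M : 'M[R[i]]_n) i j :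
  bform M (delta_mx 0 i) (delta_mx 0 j) = complex.Re (M i j).
Proof.
rewrite /bform -rowE mxE (bigD1 j) //= big1 ?addr0 => [|k kj].
  by rewrite !mxE !eqxx rmorph1 mulr1.
by rewrite !mxE (negbTE kj) rmorph0 mulr0.
Qed.

(** The factor i sits on the conjugated side, and Re (- i z) = Im z. *)
Lemma bform_idelta (R : realType) n (M : 'M[R[i]]_n) i j :
  bform M (delta_mx 0 i) ('i%C *: delta_mx 0 j) = complex.Im (M i j).
Proof.
rewrite /bform -rowE mxE (bigD1 j) //= big1 ?addr0 => [|k kj].
  by rewrite !mxE !eqxx ReM Re_conj Im_conj /=; ring.
by rewrite !mxE (negbTE kj) mulr0 rmorph0 mulr0.
Qed.

(** Polarisation for an arbitrary function [q], so that it also applies to a pointwise limit of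
    quadratic forms not yet known to come from a matrix. *)
Definition polar (R : realType) n (q : 'rV[R[i]]_n -> R) x y : R :=
  (q (x + y) - q x - q y) / 2.

Lemma bform_polar (R : realType) n (M : 'M[R[i]]_n) x y : adjmx M = M ->
  bform M x y = polar (rform M) x y.
Proof. by move=> hM; rewrite /polar rform_addv //; field. Qed.

Lemma eq_rform (R : realType) n (A B : 'M[R[i]]_n) : adjmx A = A -> adjmx B = B ->
  (forall v, rform A v = rform B v) -> A = B.
Proof.
move=> hA hB e; have eb x y : bform A x y = bform B x y.
  by rewrite !bform_polar // /polar !e.
apply/matrixP => i j; apply/eqP; rewrite eq_complex -!bform_delta -!bform_idelta.
by rewrite !eb !eqxx.
Qed.

Definition nsq (R : realType) (z : R[i]) : R := complex.Re z ^+ 2 + complex.Im z ^+ 2.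

Lemma nsq_ge0 (R : realType) (z : R[i]) : 0 <= nsq z.
Proof. by rewrite addr_ge0 ?sqr_ge0. Qed.

Lemma bform_rdiag (R : realType) n (d : 'I_n -> R) x y :
  bform (rdiag d) x y = \sum_k d k * complex.Re (x 0 k * conjc (y 0 k)).
Proof.
rewrite /bform mul_mx_diag mxE Re_sum; apply: eq_bigr => k _.
by rewrite !mxE (mulrC (x 0 k)) -mulrA Re_realM.
Qed.

(** The common shape of all matrices below: a real diagonal matrix moved by a congruence. With [S]
    unitary it is a spectral decomposition; with [S] merely invertible two matrices can share the
    same [S]. *)
Definition cmx (R : realType) n (S : 'M[R[i]]_n) (d : 'I_n -> R) : 'M[R[i]]_n :=
  adjmx S *m rdiag d *m S.

Lemma adjmx_cmx (R : realType) n (S : 'M[R[i]]_n) d : adjmx (cmx S d) = cmx S d.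
Proof. by rewrite /cmx !adjmxM adjmxK adjmx_rdiag mulmxA. Qed.

Lemma bform_cmx (R : realType) n (S : 'M[R[i]]_n) (d : 'I_n -> R) x y :
  bform (cmx S d) x y = \sum_k d k *
    complex.Re ((x *m adjmx S) 0 k * conjc ((y *m adjmx S) 0 k)).
Proof. by rewrite bform_congr bform_rdiag. Qed.

Lemma rform_cmx (R : realType) n (S : 'M[R[i]]_n) (d : 'I_n -> R) v :
  rform (cmx S d) v = \sum_k d k * nsq ((v *m adjmx S) 0 k).
Proof.
rewrite /rform bform_cmx; apply: eq_bigr => k _; congr (_ * _).
by rewrite ReM Re_conj Im_conj /nsq; ring.
Qed.

Lemma psdmx_cmx (R : realType) n (S : 'M[R[i]]_n) (d : 'I_n -> R) :
  (forall k, 0 <= d k) -> psdmx (cmx S d).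
Proof.
move=> hd; apply/psdmxE; split; first exact: adjmx_cmx.
by move=> v; rewrite rform_cmx sumr_ge0 // => k _; rewrite mulr_ge0 ?nsq_ge0.
Qed.

(** * Simultaneous diagonalisation and the geometric mean *)

Lemma invmx_unique (R : realType) n (A B : 'M[R[i]]_n) : A *m B = 1%:M -> invmx A = B.
Proof.
move=> AB; have [uA uB] := mulmx1_unit AB.
by rewrite -[invmx A]mulmx1 -AB mulKmx.
Qed.

Lemma adjmx_unit (R : realType) n (S : 'M[R[i]]_n) :
  S \in unitmx -> adjmx S \in unitmx.
Proof. by move=> uS; rewrite /adjmx map_unitmx unitmx_tr. Qed.

Lemma adjmx_inv (R : realType) n (S : 'M[R[i]]_n) :
  invmx (adjmx S) = adjmx (invmx S).
Proof. by rewrite /adjmx trmx_inv map_invmx. Qed.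

Lemma rdiag_unit (R : realType) n (d : 'I_n -> R) :
  (rdiag d \in unitmx) = [forall k, d k != 0].
Proof.
rewrite unitmxE det_diag unitfE.
apply/prodf_neq0/forallP => h k; have := h k;
  by rewrite !mxE /= (inj_eq (@complexI _)) //; apply.
Qed.

Lemma cmx_unit (R : realType) n (S : 'M[R[i]]_n) (d : 'I_n -> R) : S \in unitmx ->
  (cmx S d \in unitmx) = [forall k, d k != 0].
Proof.
move=> uS; rewrite /cmx !unitmx_mul adjmx_unit // uS andbT /=; exact: rdiag_unit.
Qed.

Lemma rdiagV (R : realType) n (d : 'I_n -> R) : (forall k, d k != 0) ->
  rdiag d *m rdiag (fun k => (d k)^-1) = 1%:M.
Proof.
move=> d0; rewrite rdiagM -[RHS]/((1%:C)%:M) -rdiag_cst; congr rdiag.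
by apply/funext => k; rewrite mulfV.
Qed.

Lemma invmx_cmx (R : realType) n (S : 'M[R[i]]_n) (d : 'I_n -> R) : S \in unitmx ->
  (forall k, d k != 0) ->
  invmx (cmx S d) = cmx (adjmx (invmx S)) (fun k => (d k)^-1).
Proof.
move=> uS d0; apply: invmx_unique; rewrite /cmx adjmxK !mulmxA mulmxK //.
rewrite -(mulmxA (adjmx S) (rdiag d)) rdiagV // mulmx1.
by rewrite -adjmx_inv mulmxV ?adjmx_unit.
Qed.

Lemma cmxD (R : realType) n (S : 'M[R[i]]_n) (d e : 'I_n -> R) :
  cmx S d + cmx S e = cmx S (fun k => d k + e k).
Proof. by rewrite /cmx -rdiagD mulmxDr mulmxDl. Qed.

(** Absorbs positive weights into the congruence: with [a] a square root of the weights of a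
    positive definite matrix, that matrix gets all weights 1. *)
Lemma cmx_mull (R : realType) n (S : 'M[R[i]]_n) (a d : 'I_n -> R) :
  cmx (rdiag a *m S) d = cmx S (fun k => a k ^+ 2 * d k).
Proof.
rewrite (_ : (fun k => _) = fun k => a k * (d k * a k)); last first.
  by apply/funext => k; ring.
by rewrite /cmx adjmxM adjmx_rdiag -!rdiagM !mulmxA.
Qed.

(** * Unitary diagonalisation and the functional calculus *)

Definition unitary (R : realType) n (U : 'M[R[i]]_n) := U *m adjmx U = 1%:M.

Lemma unitary_adjK (R : realType) n (U : 'M[R[i]]_n) : unitary U -> adjmx U *m U = 1%:M.
Proof. exact: mulmx1C. Qed.

Lemma unitary_unit (R : realType) n (U : 'M[R[i]]_n) : unitary U -> U \in unitmx.
Proof. by case/mulmx1_unit. Qed.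

Lemma mulmx_unitaryK (R : realType) m n (A : 'M[R[i]]_(m, n)) U : unitary U ->
  A *m U *m adjmx U = A.
Proof. by move=> uU; rewrite -mulmxA uU mulmx1. Qed.

Lemma mulmx_unitaryVK (R : realType) m n (A : 'M[R[i]]_(m, n)) U : unitary U ->
  A *m adjmx U *m U = A.
Proof. by move=> uU; rewrite -mulmxA unitary_adjK // mulmx1. Qed.

Lemma spectral_unitary (R : realType) n (A : 'M[R[i]]_n) : unitary (spectralmx A).
Proof. exact/unitarymxP/spectral_unitarymx. Qed.

Lemma invmx_spectral (R : realType) n (A : 'M[R[i]]_n) :
  invmx (spectralmx A) = adjmx (spectralmx A).
Proof. exact/invmx_unitary/spectral_unitarymx. Qed.

Lemma spectral_herm (R : realType) n (A : 'M[R[i]]_n) : adjmx A = A ->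
  A = invmx (spectralmx A) *m diag_mx (spectral_diag A) *m spectralmx A.
Proof.
move=> /hermsymmxE hA; exact: (orthomx_spectralP (hermitian_normalmx hA)).
Qed.

Lemma spectral_diagE (R : realType) n (A : 'M[R[i]]_n) k : adjmx A = A ->
  spectral_diag A 0 k = (complex.Re (spectral_diag A 0 k))%:C.
Proof.
move=> /hermsymmxE hA; rewrite RRe_real //.
by have /mxOverP := hermitian_spectral_diag_real hA; exact.
Qed.

Lemma spectral_diag_rdiag (R : realType) n (A : 'M[R[i]]_n) : adjmx A = A ->
  diag_mx (spectral_diag A) = rdiag (fun k => complex.Re (spectral_diag A 0 k)).
Proof.
by move=> hA; congr diag_mx; apply/rowP => k; rewrite mxE -spectral_diagE.
Qed.

Lemma cmxM (R : realType) n (U : 'M[R[i]]_n) (d e : 'I_n -> R) : unitary U ->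
  cmx U d *m cmx U e = cmx U (fun k => d k * e k).
Proof. by move=> uU; rewrite /cmx -rdiagM !mulmxA mulmx_unitaryK. Qed.

Lemma cmx_cst (R : realType) n (U : 'M[R[i]]_n) (c : R) : unitary U ->
  cmx U (fun=> c) = (c%:C)%:M.
Proof.
move=> uU.
by rewrite /cmx rdiag_cst mul_mx_scalar -scalemxAl unitary_adjK // scalemx1.
Qed.

Lemma herm_cmx (R : realType) n (A : 'M[R[i]]_n) : adjmx A = A ->
  A = cmx (spectralmx A) (fun k => complex.Re (spectral_diag A 0 k)).
Proof.
move=> hA; apply: etrans (spectral_herm hA) _.
by rewrite (spectral_diag_rdiag hA) invmx_spectral.
Qed.

Lemma nsq_eq0 (R : realType) (z : R[i]) : (nsq z == 0) = (z == 0).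
Proof. by rewrite /nsq paddr_eq0 ?sqr_ge0 // !sqrf_eq0 eq_complex. Qed.

(** The test vector is the one that S^* sends to the k-th basis vector, so a single weight
    survives. *)
Lemma rform_cmx_row (R : realType) n (S : 'M[R[i]]_n) (d : 'I_n -> R) k :
  S \in unitmx ->
  rform (cmx S d) (row k (invmx (adjmx S))) = d k.
Proof.
move=> uS; rewrite rform_cmx -row_mul mulVmx ?adjmx_unit //.
rewrite (bigD1 k) //= big1 ?addr0 => [|j jk].
  by rewrite !mxE eqxx /nsq /= expr1n expr0n addr0 mulr1.
by rewrite !mxE eq_sym (negbTE jk) /nsq /= expr0n addr0 mulr0.
Qed.

Lemma psdmx_cmx_ge0 (R : realType) n (S : 'M[R[i]]_n) (d : 'I_n -> R) k :
  S \in unitmx ->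
  psdmx (cmx S d) -> 0 <= d k.
Proof. by move=> uS pS; rewrite -(rform_cmx_row d k uS) rform_ge0. Qed.

Lemma herm_diag (R : realType) n (A : 'M[R[i]]_n) : adjmx A = A ->
  exists P, exists d : 'I_n -> R, unitary P /\ A = cmx P d.
Proof.
by move=> /herm_cmx Ad; do 2 eexists; split; [exact: spectral_unitary | exact: Ad].
Qed.

Lemma psd_diag (R : realType) n (A : 'M[R[i]]_n) : psdmx A ->
  exists P, exists d : 'I_n -> R, [/\ unitary P, forall k, 0 <= d k & A = cmx P d].
Proof.
move=> pA; have [P [d [uP Ad]]] := herm_diag (adjmx_psd pA); exists P, d; split=> // k.
by apply: (psdmx_cmx_ge0 _ (unitary_unit uP)); rewrite -Ad.
Qed.

Lemma pd_diag (R : realType) n (A : 'M[R[i]]_n) : psdmx A -> A \in unitmx ->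
  exists P, exists d : 'I_n -> R, [/\ unitary P, forall k, 0 < d k & A = cmx P d].
Proof.
move=> pA uA; have [P [d [uP d0 Ad]]] := psd_diag pA; exists P, d; split=> // k.
rewrite lt_def d0 andbT; move: k; apply/forallP.
by rewrite -(cmx_unit _ (unitary_unit uP)) -Ad.
Qed.

(* The matrix W relating two unitary diagonalisations of the same matrix
   satisfies D W = W E, hence also f(D) W = W f(E). *)
Lemma cmx_functional (R : realType) n (f : R -> R) (P U : 'M[R[i]]_n)
    (e d : 'I_n -> R) :
  unitary P -> unitary U -> cmx P e = cmx U d ->
  cmx P (fun k => f (e k)) = cmx U (fun k => f (d k)).
Proof.
move=> uP uU PU; pose W := P *m adjmx U.
have WE : rdiag e *m W = W *m rdiag d.
  have := congr1 (fun M : 'M[R[i]]_n => P *m M *m adjmx U) PU.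
  by rewrite /cmx /W /= !mulmxA !mulmx_unitaryK // uP mul1mx.
have fWE : rdiag (fun k => f (e k)) *m W = W *m rdiag (fun k => f (d k)).
  apply/matrixP => i j; have /matrixP/(_ i j) := WE.
  rewrite !mul_diag_mx !mul_mx_diag !mxE.
  set w := (\sum_j0 _); have [->|w0] := eqVneq w 0.
    by rewrite !mulr0 !mul0r.
  by rewrite [w * _]mulrC => /(mulIf w0)/complexI ->; rewrite mulrC.
have := congr1 (fun M : 'M[R[i]]_n => adjmx P *m M *m U) fWE.
by rewrite /= /cmx /W !mulmxA !mulmx_unitaryVK // unitary_adjK // !mul1mx.
Qed.

(** By [cmx_functional] the result does not depend on the chosen diagonalisation, so [spectralmx]
    can be traded for any convenient unitary matrix. *)
Lemma funcalc_cmx (R : realType) n (f : R -> R) (U : 'M[R[i]]_n) (d : 'I_n -> R) :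
  unitary U -> funcalc f (cmx U d) = cmx U (fun k => f (d k)).
Proof.
move=> uU; set A := cmx U d.
have hA : adjmx A = A by exact: adjmx_cmx.
rewrite -(cmx_functional f (spectral_unitary A) uU (esym (herm_cmx hA))).
rewrite /funcalc invmx_spectral /cmx; congr (_ *m diag_mx _ *m _).
by apply/rowP => k; rewrite !mxE.
Qed.

Lemma mxpow_cmx (R : realType) n (U : 'M[R[i]]_n) (d : 'I_n -> R) r :
  unitary U -> mxpow (cmx U d) r = cmx U (fun k => d k `^ r).
Proof. exact: funcalc_cmx. Qed.

Lemma powR_half_sqr (R : realType) (a : R) : 0 <= a -> a `^ 2^-1 * a `^ 2^-1 = a.
Proof. by move=> a0; rewrite powR12_sqrt // -expr2 sqr_sqrtr. Qed.

Lemma cmx_ones (R : realType) n (S : 'M[R[i]]_n) : cmx S (fun=> 1) = adjmx S *m S.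
Proof. by rewrite /cmx rdiag_cst mulmx1. Qed.

(** Hides the spectral data: the computation of the mean uses only that [H] and [K] are Hermitian
    and mutually inverse, and that [H] squares to [A]. *)
Lemma mxpow_half (R : realType) n (A : 'M[R[i]]_n) : psdmx A -> A \in unitmx ->
  exists H, exists K, [/\ mxpow A (2^-1) = H, mxpow A (- 2^-1) = K,
    adjmx H = H, adjmx K = K & K *m H = 1%:M /\ H *m H = A].
Proof.
move=> pA uA; have [P [a [uP ap ->]]] := pd_diag pA uA.
exists (cmx P (fun k => a k `^ 2^-1)), (cmx P (fun k => (a k `^ 2^-1)^-1)).
split; try exact: adjmx_cmx; first exact: mxpow_cmx.
  by rewrite (mxpow_cmx _ _ uP); congr cmx; apply/funext => k; rewrite powRN.
rewrite !(cmxM _ _ uP); split; last first.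
  by congr cmx; apply/funext => k; rewrite powR_half_sqr // ltW.
apply: etrans (cmx_cst 1 uP); congr cmx.
by apply/funext => k; rewrite mulVf // gt_eqF // powR_gt0.
Qed.

(** For A = S^* S the matrix S A^(-1/2) is unitary, and it diagonalises A^(-1/2) B A^(-1/2) with the
    same weights [d]. The power then acts on [d], and the outer factors A^(1/2) restore S. *)
Lemma wgmean_formula_cmx1 (R : realType) n (S : 'M[R[i]]_n) (d : 'I_n -> R) nu :
  S \in unitmx ->
  wgmean_formula nu (cmx S (fun=> 1)) (cmx S d) = cmx S (fun k => d k `^ nu).
Proof.
move=> uS; have pA : psdmx (cmx S (fun=> 1)) by apply: psdmx_cmx => k; exact: ler01.
have uA : cmx S (fun=> 1) \in unitmx.
  by rewrite cmx_unit //; apply/forallP => k; rewrite oner_eq0.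
have [H [K [HE KE hH hK [KH HH]]]] := mxpow_half pA uA.
rewrite /wgmean_formula HE KE {HE KE}; rewrite cmx_ones in HH.
have HK := mulmx1C KH.
have uU : unitary (S *m K).
  apply: mulmx1C; rewrite adjmxM hK.
  by rewrite mulmxA -(mulmxA K) -HH !mulmxA KH mul1mx HK.
have -> : K *m cmx S d *m K = cmx (S *m K) d.
  by rewrite /cmx adjmxM hK !mulmxA.
rewrite mxpow_cmx // /cmx adjmxM hK !mulmxA HK mul1mx.
by rewrite -(mulmxA _ K H) KH mulmx1.
Qed.

Lemma sim_diag (R : realType) n (A B : 'M[R[i]]_n) : psdmx A -> A \in unitmx ->
  psdmx B -> exists S, exists d : 'I_n -> R,
  [/\ S \in unitmx, forall k, 0 <= d k, A = cmx S (fun=> 1) & B = cmx S d].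
Proof.
move=> pA uA pB; have [P [a [uP ap Aa]]] := pd_diag pA uA.
have [T [uT AT]] : exists T, T \in unitmx /\ A = cmx T (fun=> 1).
  exists (rdiag (fun k => a k `^ 2^-1) *m P); split.
    rewrite unitmx_mul (unitary_unit uP) andbT rdiag_unit; apply/forallP => k.
    by rewrite gt_eqF // powR_gt0.
  rewrite cmx_mull Aa; congr cmx.
  by apply/funext => k; rewrite mulr1 expr2 powR_half_sqr // ltW.
have hB' : adjmx (adjmx (invmx T) *m B *m invmx T) = adjmx (invmx T) *m B *m invmx T.
  by rewrite !adjmxM adjmxK (adjmx_psd pB) mulmxA.
have [Q [d [uQ Bd]]] := herm_diag hB'.
have BE : B = cmx (Q *m T) d.
  have -> : cmx (Q *m T) d = adjmx T *m (adjmx (invmx T) *m B *m invmx T) *m T.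
    by rewrite Bd /cmx adjmxM !mulmxA.
  rewrite -adjmx_inv !mulmxA mulmxV ?adjmx_unit // mul1mx.
  by rewrite -mulmxA mulVmx // mulmx1.
have uS : Q *m T \in unitmx by rewrite unitmx_mul uT unitary_unit.
exists (Q *m T), d; split=> // [k|].
  by apply: (psdmx_cmx_ge0 _ uS); rewrite -BE.
by rewrite AT !cmx_ones adjmxM mulmxA mulmx_unitaryVK.
Qed.

Lemma wgmean_formula_cmx (R : realType) n (S : 'M[R[i]]_n) (a b : 'I_n -> R) nu :
  S \in unitmx -> (forall k, 0 < a k) -> (forall k, 0 <= b k) ->
  wgmean_formula nu (cmx S a) (cmx S b) = cmx S (fun k => a k * (b k / a k) `^ nu).
Proof.
move=> uS ap b0; pose T := rdiag (fun k => a k `^ 2^-1) *m S.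
have TE e : cmx T e = cmx S (fun k => a k * e k).
  rewrite cmx_mull; congr cmx; apply/funext => k.
  by rewrite expr2 powR_half_sqr // ltW.
have uT : T \in unitmx.
  rewrite unitmx_mul uS andbT rdiag_unit; apply/forallP => k.
  by rewrite gt_eqF // powR_gt0.
have -> : cmx S a = cmx T (fun=> 1).
  by rewrite TE; congr cmx; apply/funext => k; rewrite mulr1.
have -> : cmx S b = cmx T (fun k => b k / a k).
  rewrite TE; congr cmx; apply/funext => k.
  by rewrite mulrCA mulfV ?mulr1 // gt_eqF.
by rewrite wgmean_formula_cmx1.
Qed.

(** * Monotonicity of the weighted geometric mean *)

Definition pdmx (R : realType) n (A : 'M[R[i]]_n) := psdmx A /\ A \in unitmx.

Lemma pdmx_cmx (R : realType) n (S : 'M[R[i]]_n) (d : 'I_n -> R) :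
  S \in unitmx -> (forall k, 0 < d k) -> pdmx (cmx S d).
Proof.
move=> uS dp; split; first by apply: psdmx_cmx => k; exact: ltW.
by rewrite cmx_unit //; apply/forallP => k; rewrite gt_eqF.
Qed.

Lemma pd_sim_diag (R : realType) n (A B : 'M[R[i]]_n) : pdmx A -> pdmx B ->
  exists S, exists d : 'I_n -> R,
  [/\ S \in unitmx, forall k, 0 < d k, A = cmx S (fun=> 1) & B = cmx S d].
Proof.
move=> [pA uA] [pB uB]; have [S [d [uS d0 AS BS]]] := sim_diag pA uA pB.
exists S, d; split=> // k; rewrite lt_def d0 andbT; move: k; apply/forallP.
by rewrite -(cmx_unit _ uS) -BS.
Qed.

(** The difference of the two sides is |z - s w|^2. *)
Lemma Re_mul_conj_le (R : realType) (s : R) (z w : R[i]) :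
  2 * (s * complex.Re (z * conjc w)) <= nsq z + s * s * nsq w.
Proof.
case: z w => [a b] [c e]; rewrite /nsq /=.
have : 0 <= (a - s * c) ^+ 2 + (b - s * e) ^+ 2 by rewrite addr_ge0 ?sqr_ge0.
move=> h; rewrite -subr_ge0; apply: (le_trans h).
by rewrite le_eqVlt; apply/orP; left; apply/eqP; ring.
Qed.

(** First half of the variational characterisation of the weight 1/2: the mean satisfies this
    inequality, by the arithmetic-geometric inequality in each coordinate. [le_wgmean_half_of_young]
    shows that it is the largest such Hermitian matrix. *)
Lemma wgmean_formula_young (R : realType) n (A B : 'M[R[i]]_n) x y :
  pdmx A -> psdmx B ->
  2 * bform (wgmean_formula 2^-1 A B) x y <= rform A x + rform B y.
Proof.
move=> [pA uA] pB; have [S [d [uS d0 -> ->]]] := sim_diag pA uA pB.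
rewrite (wgmean_formula_cmx1 _ _ uS) bform_cmx (rform_cmx S (fun=> 1)) (rform_cmx S d).
rewrite mulr_sumr -big_split /=; apply: ler_sum => k _.
by rewrite mul1r -[d k in leRHS]powR_half_sqr // Re_mul_conj_le.
Qed.

Lemma rform_rdiag_gt0 (R : realType) n (d : 'I_n -> R) y :
  (forall k, 0 < d k) -> y != 0 -> 0 < rform (rdiag d) y.
Proof.
move=> dp /rV0Pn[j yj].
have -> : rdiag d = cmx 1%:M d.
  by rewrite /cmx adjmx1 mul1mx mulmx1.
rewrite rform_cmx adjmx1 mulmx1 (bigD1 j) //=.
rewrite ltr_pwDl ?mulr_gt0 // ?lt_def ?nsq_eq0 ?yj ?nsq_ge0 //.
by apply: sumr_ge0 => k _; rewrite mulr_ge0 ?nsq_ge0 // ltW.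
Qed.

Lemma row_cmx (R : realType) n (Q : 'M[R[i]]_n) (w : 'I_n -> R) k : unitary Q ->
  row k Q *m cmx Q w = (w k)%:C *: row k Q.
Proof.
move=> uQ; rewrite -row_mul /cmx !mulmxA uQ mul1mx.
by rewrite row_mul row_diag_mx mxE -scalemxAl -rowE.
Qed.

Lemma bform_mull (R : realType) n (M N : 'M[R[i]]_n) x y :
  bform M (x *m N) y = bform (N *m M) x y.
Proof. by rewrite /bform !mulmxA. Qed.

Lemma bform_mulr (R : realType) n (M N : 'M[R[i]]_n) x y :
  bform M x (y *m N) = bform (M *m adjmx N) x y.
Proof. by rewrite /bform adjmxM !mulmxA. Qed.

(* Test the inequality 2 Re <x Z, y> <= |x|^2 + <y D, y> on x = y D^(1/2), for y an
   eigenvector of D^(1/2) - Z. *)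
Lemma le_sqrt_of_young (R : realType) n (Z : 'M[R[i]]_n) (d : 'I_n -> R) v :
  adjmx Z = Z -> (forall k, 0 < d k) ->
  (forall x y, 2 * bform Z x y <= rform 1%:M x + rform (rdiag d) y) ->
  rform Z v <= rform (rdiag (fun k => d k `^ 2^-1)) v.
Proof.
move=> hZ dp young; set H := rdiag _.
have hH : adjmx H = H by rewrite adjmx_rdiag.
have HH : H *m H = rdiag d.
  by rewrite rdiagM; congr rdiag; apply/funext => k; rewrite powR_half_sqr // ltW.
have hW : adjmx (H - Z) = H - Z by rewrite adjmxD adjmxN hH hZ.
have [Q [w [uQ Ww]]] := herm_diag hW.
rewrite -subr_ge0 -rformB Ww; apply: rform_ge0; apply: psdmx_cmx => k.
pose y := row k Q.
have y0 : y != 0.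
  apply/eqP => y0; have : row k (Q *m adjmx Q) = row k 1%:M by rewrite uQ.
  rewrite row_mul -/y y0 mul0mx => /rowP/(_ k)/eqP.
  by rewrite !mxE eqxx eq_sym oner_eq0.
have Hp : 0 < rform H y by apply: rform_rdiag_gt0 => // j; rewrite powR_gt0.
have ZE : Z = H - cmx Q w by rewrite -Ww subKr.
have e1 : rform 1%:M (y *m H) = rform (rdiag d) y.
  by rewrite /rform bform_mull bform_mulr hH mulmx1 HH.
have e2 : bform Z (y *m H) y = rform (rdiag d) y - w k * rform H y.
  rewrite ZE bformD bformN bform_mull HH; congr (_ - _).
  rewrite bformC ?adjmx_cmx // bform_mulr hH /rform /bform mulmxA row_cmx //.
  by rewrite -!scalemxAl mxE Re_realM.
have := young (y *m H) y; rewrite e1 e2 -(pmulr_lge0 _ Hp).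
by move: (rform _ y) (w k * _) => a b; clear; lra.
Qed.

Lemma congr_invmxK (R : realType) n (S X : 'M[R[i]]_n) : S \in unitmx ->
  adjmx S *m (adjmx (invmx S) *m X *m invmx S) *m S = X.
Proof.
move=> uS; rewrite -adjmx_inv !mulmxA mulmxV ?adjmx_unit // mul1mx.
by rewrite -mulmxA mulVmx // mulmx1.
Qed.

Lemma bform_congr_inv (R : realType) n (S X : 'M[R[i]]_n) x y :
  bform (adjmx (invmx S) *m X *m invmx S) x y =
  bform X (x *m invmx (adjmx S)) (y *m invmx (adjmx S)).
Proof. by rewrite bform_congr adjmx_inv. Qed.

(** The congruence by S^(-1) turns A into 1 and B into a diagonal matrix, where the mean is the
    square root treated in [le_sqrt_of_young]. *)
Lemma le_wgmean_half_of_young (R : realType) n (A B X : 'M[R[i]]_n) v :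
  pdmx A -> pdmx B -> adjmx X = X ->
  (forall x y, 2 * bform X x y <= rform A x + rform B y) ->
  rform X v <= rform (wgmean_formula 2^-1 A B) v.
Proof.
move=> pA pB hX young; have [S [d [uS dp AS BS]]] := pd_sim_diag pA pB.
have rS (D : 'M[R[i]]_n) x :
    rform (adjmx S *m D *m S) (x *m invmx (adjmx S)) = rform D x.
  by rewrite rform_congr -(mulmxA x) mulVmx ?adjmx_unit // mulmx1.
rewrite AS BS (wgmean_formula_cmx1 _ _ uS) -{1}(congr_invmxK X uS) (rform_congr S).
rewrite [leRHS](rform_congr S); apply: le_sqrt_of_young => //.
  by rewrite !adjmxM adjmxK hX mulmxA.
move=> x y; rewrite bform_congr_inv; apply: le_trans (young _ _) _.
by rewrite AS BS !rS rdiag_cst.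
Qed.

(** The mean of the smaller pair satisfies the inequality that defines the mean of the larger pair
    as a maximum. *)
Lemma wgmean_half_le (R : realType) n (A B A' B' : 'M[R[i]]_n) v :
  pdmx A -> pdmx B -> pdmx A' -> pdmx B' ->
  (forall v, rform A v <= rform A' v) -> (forall v, rform B v <= rform B' v) ->
  rform (wgmean_formula 2^-1 A B) v <= rform (wgmean_formula 2^-1 A' B') v.
Proof.
move=> pA pB pA' pB' leA leB; apply: le_wgmean_half_of_young => // [|x y].
  have [S [d [uS dp -> ->]]] := pd_sim_diag pA pB.
  by rewrite (wgmean_formula_cmx1 _ _ uS) adjmx_cmx.
by apply: le_trans (wgmean_formula_young _ _ pA pB.1) _; rewrite lerD.
Qed.

(** * From the weight 1/2 to all weights in [0, 1] *)

Lemma closed_last (R : realType) (T : set R) x nu : closed T -> T x -> x <= nu ->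
  exists a, [/\ T a, a <= nu & forall t, T t -> t <= nu -> t <= a].
Proof.
move=> cT Tx xnu; pose U := T `&` [set t | t <= nu].
have U0 : U !=set0 by exists x.
have bU : has_ubound U by exists nu => t [].
have cU : closed U by apply: closedI => //; exact: closed_le.
have [Ta anu] : U (sup U).
  by have := closure_sup U0 bU; rewrite -(closure_id U).1.
by exists (sup U); split=> // t Tt tnu; apply: ub_le_sup.
Qed.

(** Take the points of [T] nearest to [nu] on either side. Their midpoint is again in [T] and cannot
    lie strictly between them, so they coincide with [nu]. *)
Lemma closed_midpoint_itv (R : realType) (T : set R) (x y nu : R) : closed T ->
  (forall s t, T s -> T t -> T ((s + t) / 2)) -> T x -> T y ->
  x <= nu <= y -> T nu.
Proof.
move=> cT mT Tx Ty /andP[xnu nuy].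
have [a [Ta anu amax]] := closed_last cT Tx xnu.
(* Reflecting [T] yields its first point above [nu], which is [- b]. *)
have cN : closed [set t | T (- t)].
  refine (@preimage_closed _ _ (fun t : R => - t) T _ cT) => t _.
  exact: oppr_continuous.
have [] := @closed_last _ _ (- y) (- nu) cN; rewrite /= ?opprK ?lerN2 //.
move=> b [Tb bnu bmin].
have [mnu|num] := leP ((a + - b) / 2) nu.
  have := amax _ (mT _ _ Ta Tb) mnu => mle.
  suff -> : nu = a by []; apply/le_anti/andP; split=> //; lra.
have := bmin (- ((a + - b) / 2)).
rewrite opprK lerN2 => /(_ (mT _ _ Ta Tb) (ltW num)) mle.
suff -> : nu = - b by []; apply/le_anti/andP; split=> //; lra.
Qed.

Lemma cvg_sumr (R : realType) (I : finType) (T : Type) (F : set_system T)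
    {FF : Filter F} (f : I -> T -> R) (l : I -> R) :
  (forall k, f k x @[x --> F] --> l k) ->
  \sum_k f k x @[x --> F] --> \sum_k l k.
Proof. by move=> fl; apply: cvg_big => //=; exact: add_continuous. Qed.

Lemma closed_le_fun (R : realType) (V : Type) (f g : V -> R -> R) :
  (forall v, continuous (f v)) -> (forall v, continuous (g v)) ->
  closed [set t | forall v, f v t <= g v t].
Proof.
move=> cf cg; rewrite (_ : [set t | _] =
    \bigcap_(v in setT) ((fun t => g v t - f v t) @^-1` [set x | 0 <= x])).
  apply: closed_bigI => v _.
  refine (@preimage_closed _ _ (fun t => g v t - f v t) _ _ (@closed_ge _ 0)) => t _.
  by apply: cvgB; [exact: cg | exact: cf].
apply/seteqP; split=> t /= h; first by move=> v _; rewrite /= subr_ge0.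
by move=> v; rewrite -subr_ge0; exact: h.
Qed.

Lemma powR_exp_continuous (R : realType) (a : R) : 0 < a -> continuous (powR a).
Proof.
move=> a0; rewrite (_ : powR a = (fun nu => expR (nu * ln a))).
  move=> nu; apply: (@cvg_comp _ _ _ (fun nu => nu * ln a) expR _ (nbhs (nu * ln a))).
    exact: mulrr_continuous.
  exact: continuous_expR.
by apply/funext => nu; rewrite /powR gt_eqF.
Qed.

Lemma wgmean_formula_continuous (R : realType) n (A B : 'M[R[i]]_n) v :
  pdmx A -> pdmx B -> continuous (fun nu => rform (wgmean_formula nu A B) v).
Proof.
move=> pA pB; have [S [d [uS dp -> ->]]] := pd_sim_diag pA pB.
rewrite (_ : (fun nu => _) = fun nu => \sum_k d k `^ nu * nsq ((v *m adjmx S) 0 k)).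
  move=> nu; apply: cvg_sumr => k; apply: cvgMr_tmp; exact: powR_exp_continuous.
by apply/funext => nu; rewrite (wgmean_formula_cmx1 _ _ uS) rform_cmx.
Qed.

(** In common coordinates this is d^s (d^t / d^s)^(1/2) = d^((s + t) / 2). It makes the set of
    monotone weights stable under midpoints. *)
Lemma wgmean_formula_mid (R : realType) n (A B : 'M[R[i]]_n) s t :
  pdmx A -> pdmx B -> wgmean_formula ((s + t) / 2) A B =
    wgmean_formula 2^-1 (wgmean_formula s A B) (wgmean_formula t A B).
Proof.
move=> pA pB; have [S [d [uS dp -> ->]]] := pd_sim_diag pA pB.
rewrite !(wgmean_formula_cmx1 _ _ uS) (wgmean_formula_cmx _ uS) => [|k|k]; last 2 first.
- exact: powR_gt0.
- exact: powR_ge0.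
congr cmx; apply/funext => k; have d0 : d k != 0 by rewrite gt_eqF.
rewrite -powRB ?d0 ?implybT // -powRrM -powRD ?d0 ?implybT //; congr (_ `^ _); lra.
Qed.

Lemma wgmean_formula_pd (R : realType) n (A B : 'M[R[i]]_n) nu :
  pdmx A -> pdmx B -> pdmx (wgmean_formula nu A B).
Proof.
move=> pA pB; have [S [d [uS dp -> ->]]] := pd_sim_diag pA pB.
by rewrite (wgmean_formula_cmx1 _ _ uS); apply: pdmx_cmx => // k; rewrite powR_gt0.
Qed.

Lemma wgmean_formula0 (R : realType) n (A B : 'M[R[i]]_n) :
  pdmx A -> pdmx B -> wgmean_formula 0 A B = A.
Proof.
move=> pA pB; have [S [d [uS dp -> ->]]] := pd_sim_diag pA pB.
by rewrite (wgmean_formula_cmx1 _ _ uS); congr cmx; apply/funext => k; exact: powRr0.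
Qed.

Lemma wgmean_formula1 (R : realType) n (A B : 'M[R[i]]_n) :
  pdmx A -> pdmx B -> wgmean_formula 1 A B = B.
Proof.
move=> pA pB; have [S [d [uS dp -> ->]]] := pd_sim_diag pA pB.
rewrite (wgmean_formula_cmx1 _ _ uS); congr cmx; apply/funext => k.
by rewrite powRr1 // ltW.
Qed.

Lemma wgmean_formula_le (R : realType) n (A B A' B' : 'M[R[i]]_n) nu v :
  pdmx A -> pdmx B -> pdmx A' -> pdmx B' ->
  (forall v, rform A v <= rform A' v) -> (forall v, rform B v <= rform B' v) ->
  0 <= nu <= 1 ->
  rform (wgmean_formula nu A B) v <= rform (wgmean_formula nu A' B') v.
Proof.
move=> pA pB pA' pB' leA leB nu01.
pose T := [set t | forall v,
  rform (wgmean_formula t A B) v <= rform (wgmean_formula t A' B') v].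
suff : T nu by apply.
refine (@closed_midpoint_itv _ T 0 1 nu _ _ _ _ nu01).
- by apply: (@closed_le_fun _ _ (fun v t => rform (wgmean_formula t A B) v)
    (fun v t => rform (wgmean_formula t A' B') v)) => w;
    exact: wgmean_formula_continuous.
- move=> s t hs ht w.
  rewrite (wgmean_formula_mid s t pA pB) (wgmean_formula_mid s t pA' pB').
  exact: (wgmean_half_le _ (wgmean_formula_pd s pA pB) (wgmean_formula_pd t pA pB)
    (wgmean_formula_pd s pA' pB') (wgmean_formula_pd t pA' pB') hs ht).
- by move=> w; rewrite (wgmean_formula0 pA pB) (wgmean_formula0 pA' pB').
- by move=> w; rewrite (wgmean_formula1 pA pB) (wgmean_formula1 pA' pB').
Qed.

(** * Limits of forms and the parallel sum *)

Lemma Re_iM (R : realType) (z : R[i]) : complex.Re ('i%C * z) = - complex.Im z.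
Proof. by rewrite ReM /= mul0r mul1r sub0r. Qed.

Lemma bform_ideltal (R : realType) n (M : 'M[R[i]]_n) i j :
  bform M ('i%C *: delta_mx 0 i) (delta_mx 0 j) = - complex.Im (M i j).
Proof.
have <- : complex.Re (('i%C *: M) i j) = - complex.Im (M i j) by rewrite mxE Re_iM.
by rewrite -bform_delta /bform -!scalemxAl -scalemxAr -scalemxAl.
Qed.

(** Basis vectors give the real parts of the entries; multiplying one of them by i gives the
    imaginary parts, with opposite signs on the two sides. *)
Lemma adjmx_of_bformC (R : realType) n (M : 'M[R[i]]_n) :
  (forall x y, bform M x y = bform M y x) -> adjmx M = M.
Proof.
move=> bC; apply/matrixP => i j; rewrite !mxE; apply/eqP; rewrite eq_complex.
rewrite Re_conj Im_conj -!bform_delta bC eqxx /=.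
by rewrite -bform_ideltal bC bform_idelta eqxx.
Qed.

Lemma nbhs_right0_pos (R : realType) (P : R -> Prop) :
  (forall e, 0 < e -> P e) -> \forall e \near 0^'+, P e.
Proof.
by move=> hP; near=> e; apply: hP; near: e; exact: nbhs_right_gt.
Unshelve. all: by end_near. Qed.

Lemma eq_cvg_right0 (R : realType) (f g : R -> R) (l : R) :
  (forall e, 0 < e -> f e = g e) -> g e @[e --> 0^'+] --> l ->
  f e @[e --> 0^'+] --> l.
Proof.
move=> fg; apply: cvg_trans; apply: near_eq_cvg; apply: nbhs_right0_pos => e e0.
by rewrite fg.
Qed.

Lemma bform_cvg (R : realType) n (T : Type) (G : set_system T) {FG : Filter G}
    (F : T -> 'M[R[i]]_n) (L : 'M[R[i]]_n) x y :
  (forall i j, complex.Re (F t i j) @[t --> G] --> complex.Re (L i j)) ->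
  (forall i j, complex.Im (F t i j) @[t --> G] --> complex.Im (L i j)) ->
  bform (F t) x y @[t --> G] --> bform L x y.
Proof.
move=> cRe cIm; rewrite bform_expand.
rewrite (_ : (fun t => bform (F t) x y) = fun t => \sum_i \sum_j
    (complex.Re (x 0 i * conjc (y 0 j)) * complex.Re (F t i j)
     - complex.Im (x 0 i * conjc (y 0 j)) * complex.Im (F t i j))); last first.
  by apply/funext => t; exact: bform_expand.
apply: cvg_sumr => i; apply: cvg_sumr => j.
by apply: cvgB; apply: cvgMl_tmp; [exact: cRe | exact: cIm].
Qed.

Lemma polar_cvg (R : realType) n (T : Type) (G : set_system T) {FG : Filter G}
    (F : T -> 'rV[R[i]]_n -> R) (L : 'rV[R[i]]_n -> R) x y :
  (forall v, F t v @[t --> G] --> L v) ->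
  polar (F t) x y @[t --> G] --> polar L x y.
Proof.
move=> cF; apply: cvgMr_tmp; apply: cvgB; last exact: cF.
by apply: cvgB; exact: cF.
Qed.

(** The form is nondecreasing in [e]; it decreases as [e] goes down to 0, which is the direction of
    the limits. *)
Definition form_decr (R : realType) n (F : R -> 'M[R[i]]_n) : Prop :=
  forall e e' v, 0 < e -> e <= e' -> rform (F e) v <= rform (F e') v.

Lemma form_decr_cvg (R : realType) n (F : R -> 'M[R[i]]_n) v :
  (forall e, 0 < e -> psdmx (F e)) -> form_decr F ->
  cvg (rform (F e) v @[e --> 0^'+]).
Proof.
move=> pF dF; apply: nondecreasing_at_right_is_cvgr.
  apply: nbhs_right0_pos => e e0 x y; rewrite !in_itv /= => /andP[x0 _] _ xy.
  exact: dF.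
apply: nbhs_right0_pos => e e0; exists 0 => z [x /=].
rewrite in_itv /= => /andP[x0 _] <-.
exact: rform_ge0 (pF _ x0).
Qed.

(** Polarisation turns convergence of the quadratic forms into convergence of each entry, so every
    [lim] in [mxlim0] is a genuine limit; symmetry and positivity then pass to it. *)
Lemma mxlim0_form (R : realType) n (F : R -> 'M[R[i]]_n) :
  (forall e, 0 < e -> psdmx (F e)) ->
  (forall v, cvg (rform (F e) v @[e --> 0^'+])) ->
  psdmx (mxlim0 F) /\ forall v, rform (F e) v @[e --> 0^'+] --> rform (mxlim0 F) v.
Proof.
move=> pF cF; pose q v := lim (rform (F e) v @[e --> 0^'+]).
have cb x y : bform (F e) x y @[e --> 0^'+] --> polar q x y.
  apply: (@eq_cvg_right0 _ _ (fun e => polar (rform (F e)) x y)) => [e e0|].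
    by rewrite bform_polar //; exact: adjmx_psd (pF _ e0).
  by apply: (polar_cvg (F := fun e => rform (F e))) => v; exact: cF.
have cRe i j : complex.Re (F e i j) @[e --> 0^'+] --> complex.Re (mxlim0 F i j).
  rewrite mxE /=; apply/cvg_ex; exists (polar q (delta_mx 0 i) (delta_mx 0 j)).
  by under eq_fun do rewrite -bform_delta; exact: cb.
have cIm i j : complex.Im (F e i j) @[e --> 0^'+] --> complex.Im (mxlim0 F i j).
  rewrite mxE /=; apply/cvg_ex.
  exists (polar q (delta_mx 0 i) ('i%C *: delta_mx 0 j)).
  by under eq_fun do rewrite -bform_idelta; exact: cb.
have cL x y : bform (F e) x y @[e --> 0^'+] --> bform (mxlim0 F) x y.
  exact: bform_cvg.
split; last by move=> v; exact: cL.
apply/psdmxE; split=> [|v].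
  apply: adjmx_of_bformC => x y; apply: (@norm_cvg_unique _ R _ _ _ _ (cL x y)).
  apply: (@eq_cvg_right0 _ _ (fun e => bform (F e) y x)) => [e e0|]; last exact: cL.
  by rewrite bformC //; exact: adjmx_psd (pF _ e0).
apply: (cvgr_to_ge (cL v v)); apply: nbhs_right0_pos => e e0.
exact: rform_ge0 (pF _ e0).
Qed.

Lemma form_decr_lim_le (R : realType) n (F : R -> 'M[R[i]]_n) L e v : form_decr F ->
  rform (F e) v @[e --> 0^'+] --> rform L v -> 0 < e -> rform L v <= rform (F e) v.
Proof.
move=> dF cF e0; apply: (cvgr_to_le cF); near=> x; apply: dF.
  by near: x; exact: nbhs_right_gt.
by near: x; exact: nbhs_right_le.
Unshelve. all: by end_near. Qed.

(* [P] is the parallel sum of [X] and [Y] in the sense of Anderson and Trapp: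
   its form at [v] is the infimum of those of [X] at [a] plus [Y] at [v - a]. *)
Definition is_parsum (R : realType) n (X Y P : 'M[R[i]]_n) : Prop :=
  [/\ adjmx P = P, forall v a, rform P v <= rform X a + rform Y (v - a) &
    forall v e, 0 < e -> exists a, rform X a + rform Y (v - a) <= rform P v + e].

Lemma is_parsum_le (R : realType) n (X Y P X' Y' P' : 'M[R[i]]_n) v :
  is_parsum X Y P -> is_parsum X' Y' P' ->
  (forall v, rform X v <= rform X' v) -> (forall v, rform Y v <= rform Y' v) ->
  rform P v <= rform P' v.
Proof.
move=> [_ lP _] [_ _ aP'] leX leY; apply/ler_addgt0Pr => e e0.
have [a ha] := aP' v e e0; apply: le_trans (lP v a) (le_trans _ ha).
by rewrite lerD.
Qed.

(** Allows parallel sums obtained by inverses, by coordinates or by different limits to be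
    identified. *)
Lemma is_parsum_unique (R : realType) n (X Y P P' : 'M[R[i]]_n) :
  is_parsum X Y P -> is_parsum X Y P' -> P = P'.
Proof.
move=> sP sP'; apply: eq_rform; [by case: sP | by case: sP' |] => v.
apply/le_anti; rewrite (is_parsum_le v sP sP' (fun=> lexx _) (fun=> lexx _)).
exact: (is_parsum_le v sP' sP (fun=> lexx _) (fun=> lexx _)).
Qed.

(** After multiplication by a + b the difference of the two sides is |(a + b) z - b w|^2, which
    vanishes at z = b w / (a + b). *)
Lemma parsum_scalar_le (R : realType) (a b : R) (w z : R[i]) :
  0 <= a -> 0 <= b -> 0 < a + b ->
  a * b / (a + b) * nsq w <= a * nsq z + b * nsq (w - z).
Proof.
move=> a0 b0 ab; rewrite mulrAC ler_pdivrMr //.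
case: w z => [w1 w2] [z1 z2]; rewrite /nsq /=.
have : 0 <= ((a + b) * z1 - b * w1) ^+ 2 + ((a + b) * z2 - b * w2) ^+ 2.
  by rewrite addr_ge0 ?sqr_ge0.
move=> h; rewrite -subr_ge0; apply: (le_trans h).
by rewrite le_eqVlt; apply/orP; left; apply/eqP; ring.
Qed.

Lemma parsum_scalar_eq (R : realType) (a b : R) (w : R[i]) : 0 < a + b ->
  a * nsq (w * (b / (a + b))%:C) + b * nsq (w - w * (b / (a + b))%:C) =
  a * b / (a + b) * nsq w.
Proof.
by move=> ab; case: w => [w1 w2]; rewrite /nsq /=; field; rewrite gt_eqF.
Qed.

(** The minimisation splits into coordinates. Only the sums a + b have to be positive, so one of the
    two matrices may be singular. *)
Lemma is_parsum_cmx (R : realType) n (S : 'M[R[i]]_n) (a b : 'I_n -> R) :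
  S \in unitmx -> (forall k, 0 <= a k) -> (forall k, 0 <= b k) ->
  (forall k, 0 < a k + b k) ->
  is_parsum (cmx S a) (cmx S b) (cmx S (fun k => a k * b k / (a k + b k))).
Proof.
move=> uS a0 b0 ab; split=> [|v x|v e e0]; first exact: adjmx_cmx.
  rewrite !rform_cmx -big_split /=; apply: ler_sum => k _.
  by rewrite mulmxBl !mxE; exact: parsum_scalar_le.
(* The minimiser z = b w / (a + b) of each coordinate, carried back through S^*; the infimum is
   attained. *)
exists (v *m adjmx S *m rdiag (fun k => b k / (a k + b k)) *m invmx (adjmx S)).
rewrite !rform_cmx -big_split /= ler_wpDr ?(ltW e0) //; apply: ler_sum => k _.
rewrite mulmxBl mulmxKV ?adjmx_unit // mul_mx_diag.
set w := v *m adjmx S; rewrite -(parsum_scalar_eq (w 0 k) (ab k)).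
by rewrite !mxE.
Qed.

Lemma is_parsum_pd (R : realType) n (X Y : 'M[R[i]]_n) : pdmx X -> pdmx Y ->
  psdmx (invmx (invmx X + invmx Y)) /\ is_parsum X Y (invmx (invmx X + invmx Y)).
Proof.
move=> pX pY; have [S [d [uS dp -> ->]]] := pd_sim_diag pX pY.
have uT : adjmx (invmx S) \in unitmx by rewrite adjmx_unit // unitmx_inv.
have s0 k : 0 < 1^-1 + (d k)^-1 by rewrite addr_gt0 // invr_gt0.
have d0 k : d k != 0 by rewrite gt_eqF.
rewrite (invmx_cmx uS (fun=> oner_neq0 R)) (invmx_cmx uS d0) cmxD.
rewrite (invmx_cmx uT (fun k => lt0r_neq0 (s0 k))) adjmx_inv adjmxK invmxK.
have -> : (fun k => (1^-1 + (d k)^-1)^-1) = fun k => 1 * d k / (1 + d k).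
  apply/funext => k; field; rewrite d0 /=.
  by rewrite !gt_eqF // addr_gt0.
split; last by apply: is_parsum_cmx => // k; rewrite ?ltW // addr_gt0.
by apply: psdmx_cmx => k; rewrite mul1r divr_ge0 ?addr_ge0 // ltW.
Qed.

(** An infimum over vectors commutes with a decreasing limit: the lower bound passes to the limit,
    and a near-minimiser for one small parameter is still good for the smaller limit forms. *)
Lemma is_parsum_lim (R : realType) n (X Y : 'M[R[i]]_n) (Xe Ye Pe : R -> 'M[R[i]]_n) :
  form_decr Xe -> form_decr Ye ->
  (forall v, rform (Xe e) v @[e --> 0^'+] --> rform X v) ->
  (forall v, rform (Ye e) v @[e --> 0^'+] --> rform Y v) ->
  (forall e, 0 < e -> psdmx (Pe e) /\ is_parsum (Xe e) (Ye e) (Pe e)) ->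
  [/\ psdmx (mxlim0 Pe), forall v, rform (Pe e) v @[e --> 0^'+] --> rform (mxlim0 Pe) v
    & is_parsum X Y (mxlim0 Pe)].
Proof.
move=> dX dY cX cY sP.
have pP e : 0 < e -> psdmx (Pe e) by move=> /sP[].
have dP : form_decr Pe.
  move=> e e' v e0 ee'; have e'0 := lt_le_trans e0 ee'.
  by apply: is_parsum_le (sP _ e0).2 (sP _ e'0).2 _ _ => w; [exact: dX | exact: dY].
have [pL cL] := mxlim0_form pP (fun v => @form_decr_cvg _ _ Pe v pP dP).
split=> //; split=> [|v a|v e e0]; first exact: adjmx_psd.
  apply: (ler_cvg_to (cL v) (cvgD (cX a) (cY (v - a)))).
  by apply: nbhs_right0_pos => e /sP[_ [_ h _]]; exact: h.
have e20 : 0 < e / 2 by rewrite divr_gt0.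
(* Half of the error pays for stopping at the parameter [t], the other half for the near-minimiser
   at [t]. *)
have [t [t0 ht]] : exists t, 0 < t /\ rform (Pe t) v <= rform (mxlim0 Pe) v + e / 2.
  near (0 : R)^'+ => t; exists t; split; first by near: t; exact: nbhs_right_gt.
  near: t; apply: (@cvgr_le _ _ _ _ _ _ (cL v)).
  by rewrite ltrDl.
have [_ [_ _ aP]] := sP _ t0; have [a ha] := aP v _ e20; exists a.
have hX := form_decr_lim_le dX (cX a) t0.
have hY := form_decr_lim_le dY (cY (v - a)) t0.
apply: le_trans (lerD hX hY) (le_trans ha _).
by rewrite [e in leRHS]splitr addrA lerD2r.
Unshelve. all: by end_near. Qed.

(** * Perturbation by positive multiples of the identity *)

Lemma rform_scalar (R : realType) n (e : R) (v : 'rV[R[i]]_n) :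
  rform (e%:C)%:M v = e * rform 1%:M v.
Proof. by rewrite -rformZ scalemx1. Qed.

Lemma rform1_ge0 (R : realType) n (v : 'rV[R[i]]_n) : 0 <= rform 1%:M v.
Proof.
apply: rform_ge0; rewrite -[1%:M]/((1%:C)%:M) -rdiag_cst -[rdiag _]mulmx1.
rewrite -[rdiag _]mul1mx -{1}(adjmx1 R n); apply: psdmx_cmx => k; exact: ler01.
Qed.

Lemma pdmx_add_scalar (R : realType) n (A : 'M[R[i]]_n) e : psdmx A -> 0 < e ->
  pdmx (A + (e%:C)%:M).
Proof.
move=> pA e0; have [P [d [uP d0 ->]]] := psd_diag pA.
rewrite -(cmx_cst e uP) cmxD; apply: pdmx_cmx; first exact: unitary_unit.
by move=> k; rewrite ltr_wpDl.
Qed.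

Lemma form_decr_add_scalar (R : realType) n (A : 'M[R[i]]_n) :
  form_decr (fun e => A + (e%:C)%:M).
Proof.
move=> e e' v e0 ee'; rewrite /= !rformD (rform_scalar e) (rform_scalar e') lerD2l.
by apply: ler_wpM2r ee'; exact: rform1_ge0.
Qed.

Lemma add_scalar_cvg (R : realType) n (A : 'M[R[i]]_n) v :
  rform (A + (e%:C)%:M) v @[e --> 0^'+] --> rform A v.
Proof.
have h : rform A v + e * rform 1%:M v @[e --> 0^'+] --> rform A v + 0 * rform 1%:M v.
  apply: cvgD; first exact: cvg_cst.
  by apply: cvgMr_tmp; apply: cvg_at_right_filter; exact: cvg_id.
rewrite mul0r addr0 in h; apply: cvg_trans h; apply: near_eq_cvg.
by apply: nbhs_right0_pos => e _; rewrite rformD (rform_scalar e).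
Qed.

(** Both branches of the definition obey the same variational characterisation, so later arguments
    need not distinguish them. *)
Lemma parsum_spec (R : realType) n (X Y : 'M[R[i]]_n) : psdmx X -> psdmx Y ->
  psdmx (parsum X Y) /\ is_parsum X Y (parsum X Y).
Proof.
move=> pX pY; rewrite /parsum; case: ifPn => [/andP[uX uY]|_].
  by apply: is_parsum_pd; split.
have sP e : 0 < e ->
    psdmx (invmx (invmx (X + (e%:C)%:M) + invmx (Y + (e%:C)%:M))) /\
    is_parsum (X + (e%:C)%:M) (Y + (e%:C)%:M)
      (invmx (invmx (X + (e%:C)%:M) + invmx (Y + (e%:C)%:M))).
  by move=> e0; apply: is_parsum_pd; exact: pdmx_add_scalar.
have [] := is_parsum_lim (@form_decr_add_scalar R n X) (@form_decr_add_scalar R n Y)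
  (@add_scalar_cvg R n X) (@add_scalar_cvg R n Y) sP.
by [].
Qed.

(** * The scalar inequalities *)

(* The derivative is nonnegative, so ln t and the rational function, which agree
   at t = 1, are compared on either side of 1. *)
Lemma is_derive_sub_ln (R : realType) (t : R) : 0 < t ->
  is_derive t (1 : R)
    (fun t : R => (t ^+ 3 - 1) * (t + 1) * (3 * (t ^+ 3 + t))^-1 - ln t)
    ((t - 1) ^+ 4 * (t ^+ 2 + t + 1) / (3 * t ^+ 2 * (t ^+ 2 + 1) ^+ 2)).
Proof.
move=> t0.
have t3 : 3 * (t ^+ 3 + t) != 0 by rewrite gt_eqF // mulr_gt0 // addr_gt0 // exprn_gt0.
have dl := is_derive1_ln t0.
have dD : is_derive t (1 : R) (fun t : R => 3 * (t ^+ 3 + t)) (3 * (3 * t ^+ 2 + 1)).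
  apply: trigger_derive; rewrite /GRing.scale /=; ring.
have dV := @is_deriveV _ (fun t : R => 3 * (t ^+ 3 + t)) t _ _ t3 dD.
apply: trigger_derive; rewrite /GRing.scale /=; field.
by rewrite !gt_eqF // addr_gt0 ?exprn_gt0.
Qed.

(** The mean value theorem with the derivative of [is_derive_sub_ln], whose factors are all
    nonnegative for positive arguments. *)
Lemma sub_ln_le (R : realType) (x y : R) : 0 < x -> x <= y ->
  (x ^+ 3 - 1) * (x + 1) * (3 * (x ^+ 3 + x))^-1 - ln x <=
  (y ^+ 3 - 1) * (y + 1) * (3 * (y ^+ 3 + y))^-1 - ln y.
Proof.
move=> x0 xy; pose h (t : R) := (t ^+ 3 - 1) * (t + 1) * (3 * (t ^+ 3 + t))^-1 - ln t.
rewrite -/(h x) -/(h y) -subr_ge0.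
have dh (t : R) : 0 < t -> is_derive t (1 : R) h
    ((t - 1) ^+ 4 * (t ^+ 2 + t + 1) / (3 * t ^+ 2 * (t ^+ 2 + 1) ^+ 2)).
  exact: is_derive_sub_ln.
have pos (t : R) : t \in `[x, y] -> 0 < t.
  by rewrite in_itv /= => /andP[xt _]; exact: lt_le_trans xt.
have [|c cxy ->] := @MVT_segment R h _ x y xy
    (fun t txy => dh t (pos t (subset_itv_oo_cc txy))).
  apply: derivable_within_continuous => t txy.
  by have [] := dh t (pos _ txy).
have c0 := pos _ cxy; rewrite mulr_ge0 ?subr_ge0 //.
have c2 : 0 <= c ^+ 2 + c + 1 by rewrite !addr_ge0 ?sqr_ge0 ?(ltW c0).
apply: divr_ge0; first by rewrite mulr_ge0 // exprn_even_ge0.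
by apply: mulr_ge0; [apply: mulr_ge0 => // |]; exact: sqr_ge0.
Qed.

Lemma ln_le_rational (R : realType) (t : R) : 1 <= t ->
  (t ^+ 3 + t) / (t + 1) * (3 * ln t) <= t ^+ 3 - 1.
Proof.
move=> t1; have t0 : 0 < t by exact: lt_le_trans t1.
have := sub_ln_le ltr01 t1; rewrite expr1n subrr !mul0r ln1 subr0 subr_ge0.
have p1 : 0 < t + 1 by rewrite addr_gt0.
have p3 : 0 < 3 * (t ^+ 3 + t) by rewrite mulr_gt0 // addr_gt0 // exprn_gt0.
rewrite ler_pdivlMr // => h; rewrite mulrAC ler_pdivrMr //; lra.
Qed.

Lemma ln_ge_rational (R : realType) (t : R) : 0 < t -> t <= 1 ->
  t ^+ 3 - 1 <= (t ^+ 3 + t) / (t + 1) * (3 * ln t).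
Proof.
move=> t0 t1; have := sub_ln_le t0 t1; rewrite expr1n subrr !mul0r ln1 subr0 subr_le0.
have p1 : 0 < t + 1 by rewrite addr_gt0.
have p3 : 0 < 3 * (t ^+ 3 + t) by rewrite mulr_gt0 // addr_gt0 // exprn_gt0.
rewrite ler_pdivrMr // => h; rewrite mulrAC ler_pdivlMr //; lra.
Qed.

(** * Integration over [0, 1] and the two scalar bounds *)

Lemma measure_itv01 (R : realType) : @lebesgue_measure R `[(0 : R), 1]%classic = 1%E.
Proof. by rewrite lebesgue_measure_itv /= lte_fin ltr01 oppr0 adde0. Qed.

Definition int01 (R : realType) (f : R -> R) : R :=
  Rintegral (@lebesgue_measure R) `[0%R, 1%R] f.

Definition integrable01 (R : realType) (f : R -> R) : Prop :=
  (@lebesgue_measure R).-integrable `[(0 : R), 1]%classic (EFin \o f).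

Lemma int01_cst (R : realType) (c : R) : int01 (fun=> c) = c.
Proof. by rewrite /int01 Rintegral_cst //= measure_itv01 mulr1. Qed.

Lemma int01_ge0 (R : realType) (f : R -> R) : (forall t, 0 <= f t) -> 0 <= int01 f.
Proof. by move=> f0; apply: Rintegral_ge0 => t _; exact: f0. Qed.

Lemma bounded_integrable01 (R : realType) (f : R -> R) (K : R) :
  measurable_fun (T := measurableTypeR R) `[(0 : R), 1]%classic f ->
  (forall t, 0 <= t <= 1 -> `|f t| <= K) ->
  integrable01 f.
Proof.
move=> mf fK; apply: measurable_bounded_integrable => //.
  apply: le_lt_trans (ltry 1); rewrite le_eqVlt; apply/orP; left; apply/eqP.
  exact: measure_itv01.
exists K; split; first exact: num_real.
by move=> M KM t /=; rewrite in_itv /= => /fK h; exact: le_trans h (ltW KM).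
Qed.

(** A bound uniform in the exponent; it gives integrability here and the dominating constant for the
    singular case. *)
Lemma powR_le_add1 (R : realType) (x t : R) : 0 <= x -> 0 <= t <= 1 ->
  x `^ t <= 1 + x.
Proof.
move=> x0 /andP[t0 t1]; have [x1|/ltW x1] := leP x 1.
  apply: (@le_trans _ _ 1); last by rewrite lerDl.
  have <- : 1 `^ t = 1 :> R by rewrite powR1.
  by rewrite ge0_ler_powR // nnegrE.
by rewrite (le_trans (ler1_powR x1 t1)) // lerDr.
Qed.

Lemma powR_integrable01 (R : realType) (x : R) : 0 <= x ->
  integrable01 (powR x).
Proof.
move=> x0; apply: (@bounded_integrable01 _ _ (1 + x)).
  by apply: measurable_funS (measurable_powRr x).
move=> t t01; rewrite ger0_norm ?powR_ge0 //; exact: powR_le_add1.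
Qed.

(** Here x^t = exp (t ln x) has the antiderivative exp (t ln x) / ln x, where ln x is nonzero
    because x is not 1. *)
Lemma int01_powR (R : realType) (x : R) : 0 < x -> x != 1 ->
  int01 (powR x) = (x - 1) / ln x.
Proof.
move=> x0 x1; set c := ln x.
have c0 : c != 0 by rewrite /c ln_eq0.
have E : powR x = fun t => expR (t * c) by apply/funext => t; rewrite /powR gt_eqF.
have dF (t : R) : is_derive t (1 : R) (fun t : R => expR (t * c) * c^-1) (expR (t * c)).
  by apply: trigger_derive; rewrite /GRing.scale /=; field.
have cF : continuous (fun t : R => expR (t * c) * c^-1).
  move=> t; apply/differentiable_continuous/derivable1_diffP.
  by have [] := dF t.
rewrite /int01 E /Rintegral.
rewrite (@continuous_FTC2 _ _ (fun t : R => expR (t * c) * c^-1)) //=.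
- rewrite mul1r mul0r expR0 /c lnK ?posrE //.
  by rewrite mul1r mulrBl mul1r.
- rewrite -E; apply: continuous_subspaceT; exact: powR_exp_continuous.
- split=> [t _||]; first by have [] := dF t.
    by apply: cvg_at_right_filter; exact: cF.
  by apply: cvg_at_left_filter; exact: cF.
- by move=> t _; rewrite derive1E; have [_ ->] := dF t.
Qed.

Lemma powR_int_ge (R : realType) (x : R) : 0 <= x ->
  x `^ (2 / 3) - x `^ (1 / 3) + 2 * (x `^ (1 / 3) / (x `^ (1 / 3) + 1)) <=
  int01 (powR x).
Proof.
rewrite le_eqVlt => /predU1P[<-|x0].
  rewrite !powR0 ?mul0r ?mulr0 ?addr0 ?subr0; try by apply/eqP; lra.
  by apply: int01_ge0 => t; exact: powR_ge0.
set t := x `^ (1 / 3).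
have t0 : 0 < t by exact: powR_gt0.
have xt : x = t ^+ 3.
  by rewrite -powR_mulrn ?powR_ge0 // -powRrM mul1r mulVf ?powRr1 // ltW.
have -> : x `^ (2 / 3) = t ^+ 2.
  by rewrite -powR_mulrn ?powR_ge0 // -powRrM; congr (_ `^ _); lra.
clearbody t.
have -> : t ^+ 2 - t + 2 * (t / (t + 1)) = (t ^+ 3 + t) / (t + 1).
  by field; rewrite gt_eqF // addr_gt0.
(* At t = 1 the integrand is constant; otherwise the integral is a quotient by ln x, whose sign
   decides the direction when clearing the denominator. *)
have [t1|t1|t1] := ltgtP t 1; last first.
- by rewrite xt t1 !expr1n powR1 int01_cst divff.
- rewrite int01_powR //; last by rewrite xt pexpr_eq1 ?ltW // gt_eqF.
  rewrite xt lnXn //.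
  rewrite ler_pdivlMr.
    by rewrite -[_ *+ 3]mulr_natl; apply: ln_le_rational; exact: ltW.
  by rewrite mulrn_wgt0 // ln_gt0.
rewrite int01_powR //; last by rewrite xt pexpr_eq1 ?ltW // lt_eqF.
rewrite xt lnXn //.
rewrite ler_ndivlMr.
  by rewrite -[_ *+ 3]mulr_natl; apply: ln_ge_rational => //; exact: ltW.
by rewrite mulrn_wlt0 // ln_lt0 // t0.
Qed.

Lemma powR_half_le (R : realType) (x : R) : 0 <= x ->
  x `^ (1 / 2) <= x `^ (2 / 3) - x `^ (1 / 3) + 2 * (x `^ (1 / 3) / (x `^ (1 / 3) + 1)).
Proof.
rewrite le_eqVlt => /predU1P[<-|x0].
  by rewrite !powR0 ?mul0r ?mulr0 ?addr0 ?subr0 //; apply/eqP; lra.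
(* With a sixth root the exponents 1/2, 2/3 and 1/3 become 3, 4 and 2, and the claim becomes the
   factorisation of a rational function of [s]. *)
set s := x `^ (1 / 6).
have s0 : 0 < s by exact: powR_gt0.
have -> : x `^ (1 / 2) = s ^+ 3.
  by rewrite -powR_mulrn ?powR_ge0 // -powRrM; congr (_ `^ _); lra.
have -> : x `^ (2 / 3) = s ^+ 4.
  by rewrite -powR_mulrn ?powR_ge0 // -powRrM; congr (_ `^ _); lra.
have -> : x `^ (1 / 3) = s ^+ 2.
  by rewrite -powR_mulrn ?powR_ge0 // -powRrM; congr (_ `^ _); lra.
have p : 0 < s ^+ 2 + 1 by rewrite addr_gt0 // exprn_gt0.
rewrite -subr_ge0.
have -> : s ^+ 4 - s ^+ 2 + 2 * (s ^+ 2 / (s ^+ 2 + 1)) - s ^+ 3 =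
    s ^+ 2 * ((s - 1) ^+ 2 * (s ^+ 2 + s + 1)) / (s ^+ 2 + 1).
  by field; rewrite gt_eqF.
apply: divr_ge0; last exact: ltW.
apply: mulr_ge0; first exact: sqr_ge0.
by apply: mulr_ge0; [exact: sqr_ge0 | rewrite !addr_ge0 ?sqr_ge0 // ltW].
Qed.

(** * Integrals of matrix functions *)

Lemma mem_itv01 (R : realType) (t : R) : t \in (`[(0 : R), 1]%classic : set R) ->
  0 <= t <= 1.
Proof. by rewrite inE /= in_itv. Qed.

Lemma eq_int01 (R : realType) (f g : R -> R) : (forall t, 0 <= t <= 1 -> f t = g t) ->
  int01 f = int01 g.
Proof. by move=> fg; apply: eq_Rintegral => t /mem_itv01; exact: fg. Qed.

Lemma eq_integrable01 (R : realType) (f g : R -> R) :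
  (forall t, 0 <= t <= 1 -> f t = g t) -> integrable01 f -> integrable01 g.
Proof.
by move=> fg; apply: eq_integrable => // t /mem_itv01 t01; rewrite /= fg.
Qed.

Lemma integrable01D (R : realType) (f g : R -> R) : integrable01 f -> integrable01 g ->
  integrable01 (fun t => f t + g t).
Proof. by move=> ff gg; apply: (integrableD _ ff gg). Qed.

Lemma integrable01Z (R : realType) (c : R) (f : R -> R) : integrable01 f ->
  integrable01 (fun t => c * f t).
Proof. by move=> ff; apply: (integrableZl _ c ff). Qed.

Lemma int01D (R : realType) (f g : R -> R) : integrable01 f -> integrable01 g ->
  int01 (fun t => f t + g t) = int01 f + int01 g.
Proof. by move=> ff gg; apply: RintegralD. Qed.

Lemma int01Z (R : realType) (c : R) (f : R -> R) : integrable01 f ->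
  int01 (fun t => c * f t) = c * int01 f.
Proof. by move=> ff; apply: RintegralZl. Qed.

Lemma int01_sum (R : realType) (I : finType) (f : I -> R -> R) :
  (forall i, integrable01 (f i)) ->
  integrable01 (fun t => \sum_i f i t) /\
  int01 (fun t => \sum_i f i t) = \sum_i int01 (f i).
Proof.
move=> ff; elim: (index_enum I) => [|i s [IH1 IH2]].
  have e : (fun t => \sum_(i <- [::]) f i t) = fun=> 0.
    by apply/funext => t; rewrite big_nil.
  rewrite e big_nil int01_cst; split=> //.
  by apply: (@bounded_integrable01 _ _ 0) => // t _; rewrite normr0.
have e : (fun t => \sum_(j <- i :: s) f j t) = fun t => f i t + \sum_(j <- s) f j t.
  by apply/funext => t; rewrite big_cons.
by rewrite e big_cons int01D // IH2; split=> //; exact: integrable01D.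
Qed.

Lemma integrable01_polar (R : realType) n (q : R -> 'rV[R[i]]_n -> R) x y :
  (forall v, integrable01 (q ^~ v)) -> integrable01 (fun t => polar (q t) x y).
Proof.
move=> iq; apply: (@eq_integrable01 _ (fun t =>
    2^-1 * (q t (x + y) + (- 1 * q t x + -1 * q t y)))) => [t _|].
  by rewrite /polar; field.
by apply: integrable01Z; apply: integrable01D => //; apply: integrable01D;
  exact: integrable01Z.
Qed.

Lemma int01_bform (R : realType) n (F : R -> 'M[R[i]]_n) x y :
  (forall i j, integrable01 (fun t => complex.Re (F t i j))) ->
  (forall i j, integrable01 (fun t => complex.Im (F t i j))) ->
  bform (mxint01 F) x y = int01 (fun t => bform (F t) x y).
Proof.
move=> iRe iIm.
pose G i j t := complex.Re (x 0 i * conjc (y 0 j)) * complex.Re (F t i j)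
     + - complex.Im (x 0 i * conjc (y 0 j)) * complex.Im (F t i j).
have iG i j : integrable01 (G i j).
  by apply: integrable01D; apply: integrable01Z.
have -> : (fun t => bform (F t) x y) = fun t => \sum_i \sum_j G i j t.
  apply/funext => t; rewrite bform_expand; apply: eq_bigr => i _.
  by apply: eq_bigr => j _; rewrite /G mulNr.
rewrite (int01_sum (fun i => (int01_sum (iG i)).1)).2 bform_expand.
apply: eq_bigr => i _; rewrite (int01_sum (iG i)).2; apply: eq_bigr => j _.
rewrite /G int01D ?int01Z;
  [|exact: iIm|exact: iRe|exact: integrable01Z|exact: integrable01Z].
by rewrite mulNr mxE.
Qed.

(** Polarisation derives integrability of all entries from that of the quadratic forms; the integral
    then commutes with the form by linearity. *)
Lemma mxint01_form (R : realType) n (F : R -> 'M[R[i]]_n) :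
  (forall t, 0 <= t <= 1 -> adjmx (F t) = F t) ->
  (forall v, integrable01 (fun t => rform (F t) v)) ->
  adjmx (mxint01 F) = mxint01 F /\
  forall v, rform (mxint01 F) v = int01 (fun t => rform (F t) v).
Proof.
move=> hF iF.
have ib x y : integrable01 (fun t => bform (F t) x y).
  apply: eq_integrable01 (integrable01_polar x y iF) => t t01.
  by rewrite bform_polar // hF.
have iRe i j : integrable01 (fun t => complex.Re (F t i j)).
  apply: eq_integrable01 (ib (delta_mx 0 i) (delta_mx 0 j)) => t t01.
  by rewrite bform_delta.
have iIm i j : integrable01 (fun t => complex.Im (F t i j)).
  apply: eq_integrable01 (ib (delta_mx 0 i) ('i%C *: delta_mx 0 j)) => t t01.
  by rewrite bform_idelta.
split=> [|v]; last exact: int01_bform.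
apply: adjmx_of_bformC => x y.
rewrite (int01_bform x y iRe iIm) (int01_bform y x iRe iIm).
by apply: eq_int01 => t t01; rewrite bformC // hF.
Qed.

(** Continuity of the [f_ k] serves only measurability; the limit, which may be discontinuous, is
    measurable as a pointwise limit. *)
Lemma int01_dominated (R : realType) (f_ : nat -> R -> R) (f : R -> R) (K : R) :
  (forall k, continuous (f_ k)) ->
  (forall t, 0 <= t <= 1 -> f_ k t @[k --> \oo] --> f t) ->
  (forall k t, 0 <= t <= 1 -> `|f_ k t| <= K) ->
  integrable01 f /\ int01 (f_ k) @[k --> \oo] --> int01 f.
Proof.
move=> cf ff fK.
have mf k : measurable_fun (T := measurableTypeR R) `[(0 : R), 1]%classic (f_ k).
  by apply: measurable_funS (continuous_measurable_fun (cf k)).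
have mlim : measurable_fun (T := measurableTypeR R) `[(0 : R), 1]%classic f.
  apply: (@measurable_fun_cvg _ _ _ _ f_) => // t /=; rewrite in_itv /=; exact: ff.
have iK : integrable01 (fun=> K).
  by apply: (@bounded_integrable01 _ _ `|K|) => // t _.
have [] := @dominated_convergence _ _ _ (@lebesgue_measure R) `[(0 : R), 1]%classic _
  (fun k => EFin \o f_ k) (EFin \o f) (EFin \o (fun=> K)) _ _ _ iK _.
- by [].
- by move=> k; exact/measurable_EFinP.
- exact/measurable_EFinP.
- apply: aeW => t /=; rewrite in_itv /= => t01.
  by apply: cvg_EFin; [exact: nearW | exact: ff].
- apply: aeW => t k /=; rewrite in_itv /= => t01.
  by rewrite lee_fin fK.
move=> intf _ cvgint; split; first exact: intf.
apply: fine_cvg; rewrite fineK; first exact: cvgint.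
exact: integrable_fin_num.
Qed.

(** * The matrix inequalities *)

Lemma wgmean_formula_decr (R : realType) n (A B : 'M[R[i]]_n) nu :
  psdmx A -> psdmx B -> 0 <= nu <= 1 ->
  form_decr (fun e => wgmean_formula nu (A + (e%:C)%:M) (B + (e%:C)%:M)).
Proof.
move=> pA pB nu01 e e' w e0 ee'.
have e'0 := lt_le_trans e0 ee'.
apply: (wgmean_formula_le _ (pdmx_add_scalar pA e0) (pdmx_add_scalar pB e0)
  (pdmx_add_scalar pA e'0) (pdmx_add_scalar pB e'0) _ _ nu01) => u.
  exact: (@form_decr_add_scalar R n A).
exact: (@form_decr_add_scalar R n B).
Qed.

Lemma wgmean_singular_cvg (R : realType) n (A B : 'M[R[i]]_n) nu :
  psdmx A -> psdmx B -> A \notin unitmx -> 0 <= nu <= 1 ->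
  psdmx (wgmean nu A B) /\
  forall v, rform (wgmean_formula nu (A + (e%:C)%:M) (B + (e%:C)%:M)) v @[e --> 0^'+] -->
    rform (wgmean nu A B) v.
Proof.
move=> pA pB nA nu01; rewrite /wgmean (negbTE nA).
have pF e : 0 < e -> psdmx (wgmean_formula nu (A + (e%:C)%:M) (B + (e%:C)%:M)).
  move=> e0; have pAe := pdmx_add_scalar pA e0; have pBe := pdmx_add_scalar pB e0.
  by have [] := wgmean_formula_pd nu pAe pBe.
have dF := wgmean_formula_decr pA pB nu01.
have [pL cL] := mxlim0_form pF (fun v => @form_decr_cvg _ _ _ v pF dF).
by split.
Qed.

Lemma wgmean_unit (R : realType) n (A B : 'M[R[i]]_n) nu : A \in unitmx ->
  wgmean nu A B = wgmean_formula nu A B.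
Proof. by rewrite /wgmean => ->. Qed.

Lemma wgmean_psd (R : realType) n (A B : 'M[R[i]]_n) nu :
  psdmx A -> psdmx B -> 0 <= nu <= 1 -> psdmx (wgmean nu A B).
Proof.
move=> pA pB nu01; have [uA|nA] := boolP (A \in unitmx); last first.
  exact: (wgmean_singular_cvg pA pB nA nu01).1.
rewrite (wgmean_unit _ _ uA); have [S [d [uS d0 -> ->]]] := sim_diag pA uA pB.
rewrite (wgmean_formula_cmx1 _ _ uS); apply: psdmx_cmx => k; exact: powR_ge0.
Qed.

(** A bound independent of [nu], needed to dominate the integrands. *)
Lemma wgmean_formula_le_add (R : realType) n (A B : 'M[R[i]]_n) nu v :
  pdmx A -> pdmx B -> 0 <= nu <= 1 ->
  rform (wgmean_formula nu A B) v <= rform A v + rform B v.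
Proof.
move=> pA pB nu01; have [S [d [uS d0 -> ->]]] := pd_sim_diag pA pB.
rewrite (wgmean_formula_cmx1 _ _ uS) -rformD cmxD !rform_cmx.
apply: ler_sum => k _; rewrite ler_wpM2r ?nsq_ge0 //.
by apply: powR_le_add1 nu01; exact: ltW.
Qed.

Definition middle_mx (R : realType) n (A B : 'M[R[i]]_n) : 'M[R[i]]_n :=
  wgmean (2 / 3) A B - wgmean (1 / 3) A B
  + 2 *: parsum (wgmean (1 / 3) A B) A.

Lemma rform_middle_mx (R : realType) n (A B : 'M[R[i]]_n) v :
  rform (middle_mx A B) v = rform (wgmean (2 / 3) A B) v
    - rform (wgmean (1 / 3) A B) v + 2 * rform (parsum (wgmean (1 / 3) A B) A) v.
Proof.
have -> : middle_mx A B = wgmean (2 / 3) A B - wgmean (1 / 3) A B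
    + (2 : R)%:C *: parsum (wgmean (1 / 3) A B) A.
  by rewrite /middle_mx; congr (_ + _ *: _); rewrite rmorph_nat.
by rewrite rformD rformB rformZ.
Qed.

(** In common coordinates all three forms are sums over [k] with the same nonnegative weights [w k],
    so the scalar inequalities apply term by term. *)
Lemma middle_bounds_unit (R : realType) n (A B : 'M[R[i]]_n) v :
  psdmx A -> A \in unitmx -> psdmx B ->
  [/\ integrable01 (fun nu => rform (wgmean nu A B) v),
    rform (middle_mx A B) v <= int01 (fun nu => rform (wgmean nu A B) v) &
    rform (wgmean (1 / 2) A B) v <= rform (middle_mx A B) v].
Proof.
move=> pA uA pB; have [S [d [uS d0 AS BS]]] := sim_diag pA uA pB.
have wE nu : wgmean nu A B = cmx S (fun k => d k `^ nu).
  by rewrite (wgmean_unit _ _ uA) AS BS (wgmean_formula_cmx1 _ _ uS).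
have pE : parsum (wgmean (1 / 3) A B) A =
    cmx S (fun k => d k `^ (1 / 3) * 1 / (d k `^ (1 / 3) + 1)).
  have pX : psdmx (cmx S (fun k => d k `^ (1 / 3))).
    by apply: psdmx_cmx => k; exact: powR_ge0.
  (* A singular [B] makes some [d k] zero and puts [parsum] in its limit branch, so its value is
     found by uniqueness rather than by inverting. *)
  have sP := (parsum_spec pX pA).2; rewrite wE.
  apply: (is_parsum_unique sP); rewrite {1}AS.
  apply: is_parsum_cmx => // k; first exact: powR_ge0.
  by rewrite ltr_wpDl // powR_ge0.
set w := fun k => nsq ((v *m adjmx S) 0 k).
have iw k : integrable01 (fun nu => w k * (d k `^ nu)).
  by apply: integrable01Z; exact: powR_integrable01.
have E nu : rform (wgmean nu A B) v = \sum_k w k * (d k `^ nu).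
  by rewrite wE rform_cmx; apply: eq_bigr => k _; rewrite mulrC.
have F : rform (middle_mx A B) v = \sum_k w k * (d k `^ (2 / 3) - d k `^ (1 / 3)
    + 2 * (d k `^ (1 / 3) / (d k `^ (1 / 3) + 1))).
  have e3 : rform (parsum (wgmean (1 / 3) A B) A) v =
      \sum_k w k * (d k `^ (1 / 3) / (d k `^ (1 / 3) + 1)).
    by rewrite pE rform_cmx; apply: eq_bigr => k _; rewrite mulr1 mulrC.
  apply: etrans (rform_middle_mx A B v) _.
  apply: etrans (f_equal3 (fun a b c => a - b + 2 * c) (E (2 / 3)) (E (1 / 3)) e3) _.
  rewrite mulr_sumr -sumrB -big_split /=.
  by apply: eq_bigr => k _; ring.
have -> : (fun nu => rform (wgmean nu A B) v) = fun nu => \sum_k w k * (d k `^ nu).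
  by apply/funext => nu; exact: E.
have [int sumE] := int01_sum iw.
split; first exact: int.
  rewrite F sumE; apply: ler_sum => k _.
  rewrite (int01Z _ (powR_integrable01 (d0 k))) ler_wpM2l ?nsq_ge0 //.
  exact: powR_int_ge.
rewrite E F; apply: ler_sum => k _; rewrite ler_wpM2l ?nsq_ge0 //.
exact: powR_half_le.
Qed.

Lemma third_itv01 (R : realType) : 0 <= (1 / 3 : R) <= 1.
Proof. by apply/andP; split; lra. Qed.

Lemma two_thirds_itv01 (R : realType) : 0 <= (2 / 3 : R) <= 1.
Proof. by apply/andP; split; lra. Qed.

Lemma half_itv01 (R : realType) : 0 <= (1 / 2 : R) <= 1.
Proof. by apply/andP; split; lra. Qed.

Lemma middle_mx_cvg (R : realType) n (A B : 'M[R[i]]_n) v :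
  psdmx A -> psdmx B -> A \notin unitmx ->
  rform (middle_mx (A + (e%:C)%:M) (B + (e%:C)%:M)) v @[e --> 0^'+] -->
    rform (middle_mx A B) v.
Proof.
move=> pA pB nA.
pose G nu e := wgmean_formula nu (A + (e%:C)%:M) (B + (e%:C)%:M).
have GE nu e : 0 < e -> wgmean nu (A + (e%:C)%:M) (B + (e%:C)%:M) = G nu e.
  by move=> e0; rewrite (wgmean_unit _ _ (pdmx_add_scalar pA e0).2).
have pG nu e : 0 < e -> psdmx (G nu e).
  move=> e0.
  exact: (wgmean_formula_pd nu (pdmx_add_scalar pA e0) (pdmx_add_scalar pB e0)).1.
have [pX cX] := wgmean_singular_cvg pA pB nA (third_itv01 R).
have [_ cY] := wgmean_singular_cvg pA pB nA (two_thirds_itv01 R).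
have sP e : 0 < e -> psdmx (parsum (G (1 / 3) e) (A + (e%:C)%:M)) /\
    is_parsum (G (1 / 3) e) (A + (e%:C)%:M) (parsum (G (1 / 3) e) (A + (e%:C)%:M)).
  by move=> e0; apply: parsum_spec (pG _ _ e0) (pdmx_add_scalar pA e0).1.
have [_ cP sL] := is_parsum_lim (wgmean_formula_decr pA pB (third_itv01 R))
  (@form_decr_add_scalar R n A) cX (@add_scalar_cvg R n A) sP.
(* The limit taken here runs along the means of the shifted matrices, whereas [parsum] shifts the
   limiting mean itself; uniqueness identifies the two. *)
rewrite (is_parsum_unique sL (parsum_spec pX pA).2) in cP.
apply: (@eq_cvg_right0 _ _ (fun e => rform (G (2 / 3) e) v - rform (G (1 / 3) e) v
  + 2 * rform (parsum (G (1 / 3) e) (A + (e%:C)%:M)) v)) => [e e0|].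
  by rewrite -(GE (2 / 3) e e0) -(GE (1 / 3) e e0); exact: rform_middle_mx.
have := cvgD (cvgB (cY v) (cX v)) (@cvgMl_tmp _ _ _ _ _ 2 _ (cP v)).
rewrite -(rform_middle_mx A B v); exact.
Qed.

Lemma middle_bounds_singular (R : realType) n (A B : 'M[R[i]]_n) v :
  psdmx A -> psdmx B -> A \notin unitmx ->
  [/\ integrable01 (fun nu => rform (wgmean nu A B) v),
    rform (middle_mx A B) v <= int01 (fun nu => rform (wgmean nu A B) v) &
    rform (wgmean (1 / 2) A B) v <= rform (middle_mx A B) v].
Proof.
move=> pA pB nA.
have cU := @middle_mx_cvg R n A B v pA pB nA.
have ub e : 0 < e -> _ := fun e0 => middle_bounds_unit v (pdmx_add_scalar pA e0).1
  (pdmx_add_scalar pA e0).2 (pdmx_add_scalar pB e0).1.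
(* Dominated convergence is stated for sequences, so [e] runs through 1 / (k + 1). *)
pose u k : R := k.+1%:R^-1.
have u0 k : 0 < u k by rewrite /u invr_gt0.
have ucvg : u k @[k --> \oo] --> (0 : R) by exact: cvg_harmonic.
pose g k nu := rform (wgmean_formula nu (A + ((u k)%:C)%:M) (B + ((u k)%:C)%:M)) v.
have pAu k := pdmx_add_scalar pA (u0 k); have pBu k := pdmx_add_scalar pB (u0 k).
(* The dominating constant is the bound at e = 1: every [u k] is at most 1 and the means grow with
   [e]. *)
have [||| intf cint] := @int01_dominated R g (fun nu => rform (wgmean nu A B) v)
    (rform (A + (1%:C)%:M) v + rform (B + (1%:C)%:M) v).
- by move=> k; exact: wgmean_formula_continuous.
- move=> t t01; have [_ cG] := wgmean_singular_cvg pA pB nA t01.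
  exact: ((cvg_at_rightP _ _ _).1 (cG v) u).
- move=> k t t01; rewrite ger0_norm; last first.
    exact: rform_ge0 (wgmean_formula_pd t (pAu k) (pBu k)).1.
  have uk1 : u k <= 1 by rewrite /u invf_le1 // ler1n.
  apply: le_trans (wgmean_formula_decr pA pB t01 v (u0 k) uk1) _.
  by apply: wgmean_formula_le_add t01; exact: pdmx_add_scalar.
split=> //.
  have cUu := (cvg_at_rightP _ _ _).1 cU u (conj u0 ucvg).
  apply: (ler_cvg_to cUu cint); apply: nearW => k.
  have [_ h _] := ub _ (u0 k); apply: le_trans h _; rewrite le_eqVlt; apply/orP; left.
  by apply/eqP/eq_int01 => t _; rewrite /g (wgmean_unit _ _ (pAu k).2).
have [_ cH] := wgmean_singular_cvg pA pB nA (half_itv01 R).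
apply: (ler_cvg_to (cH v) cU); apply: nbhs_right0_pos => e e0.
by have [_ _] := ub _ e0; rewrite (wgmean_unit _ _ (pdmx_add_scalar pA e0).2).
Qed.

Lemma adjmx_subD2 (R : realType) n (X Y Z : 'M[R[i]]_n) :
  adjmx X = X -> adjmx Y = Y -> adjmx Z = Z -> adjmx (X - Y + 2 *: Z) = X - Y + 2 *: Z.
Proof.
move=> hX hY hZ; have -> : (2 : R[i]) = (2 : R)%:C by rewrite rmorph_nat.
by rewrite !adjmxD adjmxN adjmxZ hX hY hZ.
Qed.

Lemma adjmx_middle_mx (R : realType) n (A B : 'M[R[i]]_n) :
  psdmx A -> psdmx B -> adjmx (middle_mx A B) = middle_mx A B.
Proof.
move=> pA pB; have p13 := wgmean_psd pA pB (third_itv01 R).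
have p23 := wgmean_psd pA pB (two_thirds_itv01 R); have [pP _] := parsum_spec p13 pA.
exact: (adjmx_subD2 (adjmx_psd p23) (adjmx_psd p13) (adjmx_psd pP)).
Qed.

Theorem proposition4p4 (R : realType) (n : nat) (A B : 'M[R[i]]_n)
    (hA : psdmx A) (hB : psdmx B) :
  let M := wgmean (2 / 3) A B - wgmean (1 / 3) A B
           + 2 *: parsum (wgmean (1 / 3) A B) A in
  loewner_le M (mxint01 (fun nu : R => wgmean nu A B)) /\
  loewner_le (wgmean (1 / 2) A B) M.
Proof.
move=> M; rewrite -[M]/(middle_mx A B).
have hM := adjmx_middle_mx hA hB.
have bounds v : [/\ integrable01 (fun nu => rform (wgmean nu A B) v),
    rform (middle_mx A B) v <= int01 (fun nu => rform (wgmean nu A B) v) &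
    rform (wgmean (1 / 2) A B) v <= rform (middle_mx A B) v].
  by have [uA|nA] := boolP (A \in unitmx);
    [exact: middle_bounds_unit | exact: middle_bounds_singular].
have [|| hI eI] := @mxint01_form R n (fun nu => wgmean nu A B).
- by move=> t t01; exact: adjmx_psd (wgmean_psd hA hB t01).
- by move=> v; have [] := bounds v.
have hH := adjmx_psd (wgmean_psd hA hB (half_itv01 R)).
split.
  by apply/(loewner_leE hM hI) => v; rewrite eI; have [] := bounds v.
by apply/(loewner_leE hH hM) => v; have [] := bounds v.
Qed.
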